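(* Consider the Erlang-C system. There exists a constant $C>0$ (independent of $\lambda$, $n$ and $\mu$) such that for all integers $n\ge1$ and all $\lambda>0$, $\mu>0$ satisfying $1\le R<n$, $$d_{W_2}(\tilde X(\infty),Y_S(\infty)):=\sup_{h\in W_2}\big|\mathbb{E}h(\tilde X(\infty))-\mathbb{E}h(Y_S(\infty))\big|\le\frac{C}{R}.$$
   Context: Erlang-C system: $n$ homogeneous servers, Poisson arrivals with rate $\lambda$, i.i.d. exponential service times with mean $1/\mu$, first-come-first-serve, infinite buffer, no abandonment. The customer count $X=\{X(t),t\ge0\}$ is the birth-death process on $\{0,1,2,\dots\}$ with birth rate $\lambda$ in every state and death rate $\mu(k\wedge n)$ in state $k$. Set $R=\lambda/\mu$, $\delta=1/\sqrt R$, $\zeta=\delta(R-n)$; when $R<n$, $X$ is positive recurrent and $X(\infty)$ denotes a random variable with its stationary distribution, and $\tilde X(\infty)=\delta(X(\infty)-R)$. Define $b(x)=-\mu x$ for $x\le-\zeta$ and $b(x)=\mu\zeta$ for $x\ge-\zeta$; define $a(x)=\mu$ for $x\le-1/\delta$, $a(x)=\mu(2+\delta x)$ for $x\in[-1/\delta,-\zeta]$, and $a(x)=\mu(2+\delta|\zeta|)$ for $x\ge-\zeta$. $Y_S(\infty)$ is a continuous random variable on $\mathbb{R}$ with density $\frac{\kappa}{a(x)}\exp\big(\int_0^x\frac{2b(y)}{a(y)}dy\big)$, $\kappa>0$ the normalizing constant. $\mathrm{Lip}(1)$ is the set of $h:\mathbb{R}\to\mathbb{R}$ with $|h(x)-h(y)|\le|x-y|$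 for all $x,y$, and $W_2$ is the set of differentiable $h:\mathbb{R}\to\mathbb{R}$ such that both $h$ and $h'$ belong to $\mathrm{Lip}(1)$. *)

(* Defs.v *)
From HB Require Import structures.
From mathcomp Require Import all_boot all_order all_algebra.
From mathcomp Require Import all_classical all_reals all_analysis.

Set Implicit Arguments.
Unset Strict Implicit.
Unset Printing Implicit Defensive.

Import Order.TTheory GRing.Theory Num.Theory.
Import numFieldNormedType.Exports.

Local Open Scope classical_set_scope.
Local Open Scope ring_scope.

Section continuous_time_markov_chains.
Context {R : realType}.

(* [p t i j] is the probability of moving from [i] to [j] in time [t]; its
   values at [t < 0] are irrelevant. *)
Definition transition_function (p : R -> nat -> nat -> R) : Prop :=
  [/\ forall t i j, 0 <= t -> 0 <= p t i j,
      forall t i, 0 <= t -> (\sum_(j <oo) (p t i j)%:E = 1)%E,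
      forall i j, p 0 i j = (i == j)%:R &
      forall s t i k, 0 <= s -> 0 <= t ->
        (\sum_(j <oo) (p s i j * p t j k)%:E = (p (s + t) i k)%:E)%E].

Definition has_rates (p : R -> nat -> nat -> R) (q : nat -> nat -> R) : Prop :=
  forall i j, (p t i j - (i == j)%:R) / t @[t --> 0^'+] --> q i j.

Definition birth_death_rates (birth death : nat -> R) (i j : nat) : R :=
  if j == i.+1 then birth i
  else if i == j.+1 then death i
  else if i == j then - (birth i + death i)
  else 0.

Definition stationary_distribution (p : R -> nat -> nat -> R)
    (m : set nat -> \bar R) : Prop :=
  forall t j, 0 <= t ->
    (\sum_(i <oo) m [set i] * (p t i j)%:E = m [set j])%E.

End continuous_time_markov_chains.

Section erlang_C.
Context {R : realType}.
Variables (n : nat) (lambda mu : R).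

(* The rates are bounded, so they determine the transition function. *)
Definition erlangC_transition (p : R -> nat -> nat -> R) : Prop :=
  transition_function p /\
  has_rates p (birth_death_rates (fun=> lambda)
                                 (fun k => mu * (minn k n)%:R)).

Definition load : R := lambda / mu.

Definition delta : R := (Num.sqrt load)^-1.

Definition zeta : R := delta * (load - n%:R).

Definition scaled_count (k : nat) : R := delta * (k%:R - load).

Definition drift (x : R) : R := if x <= - zeta then - mu * x else mu * zeta.

Definition diffusion (x : R) : R :=
  if x <= - delta^-1 then mu
  else if x <= - zeta then mu * (2 + delta * x)
  else mu * (2 + delta * `|zeta|).

End erlang_C.

(* Integral of [g] from [0] to [x], with the usual sign when [x < 0]. *)
Definition oriented_integral0 {R : realType} (g : R -> R) (x : R) : R :=
  if 0 <= x then \int[@lebesgue_measure R]_(y in `[0, x]) g y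
  else - \int[@lebesgue_measure R]_(y in `[x, 0]) g y.

Definition has_density {R : realType} d (T : measurableType d)
    (P : probability T R) (Y : {RV P >-> R}) (f : R -> R) : Prop :=
  forall A : set R, measurable A ->
    distribution P Y A = (\int[@lebesgue_measure R]_(x in A) (f x)%:E)%E.

(* The law of Y_S(oo). Taking [A = setT] in [has_density] forces [kappa] to be
   the normalizing constant. *)
Definition diffusion_limit {R : realType} (n : nat) (lambda mu : R)
    d (T : measurableType d) (P : probability T R) (Y : {RV P >-> R}) : Prop :=
  exists2 kappa : R, 0 < kappa &
    has_density Y (fun x =>
      kappa / diffusion n lambda mu x *
      expR (oriented_integral0
              (fun y => 2 * drift n lambda mu y / diffusion n lambda mu y) x)).

Definition Lip1 {R : realType} : set (R -> R) :=
  [set h : R -> R | forall x y, `|h x - h y| <= `|x - y|].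

Definition W2 {R : realType} : set (R -> R) :=
  [set h : R -> R | [/\ forall x, derivable h x 1, Lip1 h & Lip1 (h^`())%classic]].

(* Valued in the extended reals: by the conventions of [\bar R] it is [+oo] as
   soon as one of the expectations is infinite. *)
Definition dW2 {R : realType} d1 (T1 : measurableType d1) (P1 : probability T1 R)
    (U : T1 -> R) d2 (T2 : measurableType d2) (P2 : probability T2 R)
    (V : T2 -> R) : \bar R :=
  ereal_sup [set `| 'E_P1[h \o U] - 'E_P2[h \o V] |%E | h in W2].

(* Main.v *)
Require Import Defs.
From HB Require Import structures.
From mathcomp Require Import all_boot all_order all_algebra.
From mathcomp Require Import all_classical all_reals all_analysis.
From mathcomp Require Import measurable_realfun ring lra zify.

Set Implicit Arguments.
Unset Strict Implicit.
Unset Printing Implicit Defensive.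

Import Order.TTheory GRing.Theory Num.Theory.
Import numFieldNormedType.Exports.

Local Open Scope classical_set_scope.
Local Open Scope ring_scope.

(** The proof is Stein's method, organised so that only crude polynomial bounds
on the solution of the Stein equation are needed.

After dividing all rates by mu the problem has two parameters: the mesh
delta <= 1 and beta = - zeta > 0, the scaled position of the state n.  The
chain lives on the grid x_k = delta (k - R), which starts at - 1/delta and
meets beta at k = n.  With M = max(1, 1/beta), fix h in W2 and put
r = h - E h(Y).  The Stein equation
                       a g' / 2 + b g = r
has a solution g that grows linearly, because r has mean zero for the law of
Y.  The jump rates of the chain satisfy detailed balance
([birth_death_detailed_balance]), so for every F the sum of
m_k (F(x_k) - e_k F(x_k - delta)), where e_k is the death rate divided by the
birth rate, telescopes to a boundary term that vanishes at infinity
([sum_stein]).  For the trapezoidal choice F(x) = (g(x) + g(x + delta)) /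
(2 delta) each summand is m_k (r(x_k) + rem_k) ([stein_rem_eq]): the first
order terms reproduce the Stein equation, and rem_k is an error of second
order.  Hence E h(X) - E h(Y) = - E rem, and it remains to see that
E |rem| <= C delta^2.

Away from the kink at beta, rem_k is controlled by the second difference of
g', that is by delta^2 times a bound on the third derivative of g.
- Right of beta the coefficients are constant; g' is (1/beta)-Lipschitz, since
  a difference of g' solves a linear equation whose solutions either grow
  exponentially or are bounded by the data ([linear_growth_comparison]).  The
  factor beta in the drift cancels 1/beta, and |rem_k| <= 5/2 delta^2
  ([stein_rem_right]).
- Left of beta, |g| <= 21 M by comparison with explicit supersolutions
  ([stein_sol_bound_left]); the equation then bounds rem_k by a multiple of
  M (1 + |x_k|)^3 delta^2 ([stein_rem_left]).  The factor M, large when beta is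
  small, is compensated by P(X <= n) <= 16 beta ([left_mass]), while the cubic
  moment on {X <= n} is at most 20 P(X <= n) ([left_cubic_moment]).
- At the kink g' is only Lipschitz, so rem_n is of order
  M (1 + beta)^3 delta ([stein_rem_kink]); the missing factor delta comes from
  P(X = n), which is at most delta beta and at most 7 delta / beta^3
  ([boundary_mass_le], [boundary_mass_tail]).

All the moment bounds on the chain come from the same summation identity with
F an explicit elementary function.  Finally |r(x)| <= |x| + E|Y|, and
E|Y| <= 2 M follows by applying the generator of the diffusion to x^2/2
([diffusion_first_moment]). *)

(** * Mean value inequalities *)

Section mean_value.
Context {R : realType}.
Implicit Types F g : R -> R.

Lemma MVT_is_derive F F' (u v : R) : u <= v ->
  (forall x : R, u <= x <= v -> is_derive x 1 F (F' x)) ->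
  exists2 x, u <= x <= v & F v - F u = F' x * (v - u).
Proof.
move=> uv dF.
have [||x xuv ->] := @MVT_segment R F F' u v uv.
- by move=> x; rewrite in_itv/= => /andP[ux xv]; apply: dF; rewrite (ltW ux) ltW.
- apply: derivable_within_continuous => x.
  by rewrite in_itv/= => xuv; have [] := dF _ xuv.
- by exists x.
Qed.

Lemma is_derive_nonincreasing F F' (u v : R) : u <= v ->
  (forall x : R, u <= x <= v -> is_derive x 1 F (F' x)) ->
  (forall x, u <= x <= v -> F' x <= 0) -> F v <= F u.
Proof.
move=> uv dF F'0; have [x xuv h] := MVT_is_derive uv dF.
by rewrite -subr_le0 h mulr_le0_ge0 ?F'0// subr_ge0.
Qed.

Lemma mean_value_ineq F F' (K u v : R) : u <= v ->
  (forall x : R, u <= x <= v -> is_derive x 1 F (F' x)) ->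
  (forall x, u <= x <= v -> `|F' x| <= K) -> `|F v - F u| <= K * (v - u).
Proof.
move=> uv dF F'K; have [x xuv ->] := MVT_is_derive uv dF.
by rewrite normrM (ger0_norm (_ : 0 <= v - u)) ?subr_ge0// ler_wpM2r ?F'K ?subr_ge0.
Qed.

Lemma is_derive_translate g (d x t : R) :
  is_derive (x + t) 1 g d -> is_derive t 1 (fun s => g (x + s)) d.
Proof.
move=> dg; have h : is_derive t 1 (cst x + id) (1 : R).
  by apply: is_derive_eq; rewrite ?add0r ?sub0r.
by rewrite -[d]mulr1; exact: (is_derive1_comp dg h).
Qed.

Lemma is_derive_reflect g (d x t : R) :
  is_derive (x - t) 1 g d -> is_derive t 1 (fun s => g (x - s)) (- d).
Proof.
move=> dg; have h : is_derive t 1 (cst x - id) (- 1 : R).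
  by apply: is_derive_eq; rewrite ?add0r ?sub0r.
have e : d * -1 = - d by rewrite mulrN1.
by rewrite -e; exact: (@is_derive1_comp _ g (cst x - id) t d (-1) dg h).
Qed.

(** Only the Lipschitz behaviour of g' between x and x + t matters: at the kink
of the coefficients the two sides of x are governed by different constants. *)
Lemma taylor1_directed g g' (x t L : R) : (forall y : R, is_derive y 1 g (g' y)) ->
  (forall u, 0 <= u <= 1 -> `|g' (x + u * t) - g' x| <= L * (u * `|t|)) -> 0 <= L ->
  `|g (x + t) - g x - t * g' x| <= L * t ^+ 2.
Proof.
move=> dg Lg L0.
pose F u := g (x + u * t) - u * (t * g' x).
have dF (u : R) : is_derive u 1 F (t * (g' (x + u * t) - g' x)).
  have h : is_derive u 1 (cst x + id * cst t) (t : R).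
    by apply: is_derive_eq; rewrite /GRing.scale /=; ring.
  have ? : is_derive u 1 (fun v => g (x + v * t)) (g' (x + u * t) * t).
    exact: (@is_derive1_comp _ g (cst x + id * cst t) u _ t (dg _) h).
  by apply: is_derive_eq; rewrite /GRing.scale /=; ring.
have -> : g (x + t) - g x - t * g' x = F 1 - F 0.
  by rewrite /F !mul1r !mul0r addr0 subr0; ring.
have -> : t ^+ 2 = `|t| * `|t| by rewrite -expr2 -normrX ger0_norm// sqr_ge0.
have := mean_value_ineq (K := L * (`|t| * `|t|)) ler01 (fun u _ => dF u).
rewrite subr0 mulr1; apply=> u /andP[u0 u1].
rewrite normrM mulrCA ler_wpM2l//; apply: le_trans (Lg u _) _; first by rewrite u0.
by rewrite ler_wpM2l// ler_piMl.
Qed.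

Lemma taylor1 g g' (x s L : R) : (forall y : R, is_derive y 1 g (g' y)) ->
  (forall y, `|y - x| <= s -> `|g' y - g' x| <= L * `|y - x|) -> 0 <= L ->
  forall t, `|t| <= s -> `|g (x + t) - g x - t * g' x| <= L * t ^+ 2.
Proof.
move=> dg Lg L0 t ts; apply: taylor1_directed => // u /andP[u0 u1].
have e : `|x + u * t - x| = u * `|t|.
  by rewrite addrAC subrr add0r normrM (ger0_norm u0).
rewrite -e; apply: Lg; rewrite e; apply: le_trans ts.
by rewrite ler_piMl.
Qed.

(** Second differences of g' replace the third derivative of g, which need not
exist when the data are merely C^1 with Lipschitz derivative. *)
Lemma taylor2_centered g g' (x s K : R) : 0 <= s ->
  (forall y : R, is_derive y 1 g (g' y)) ->
  (forall t, 0 <= t <= s -> `|g' (x + t) + g' (x - t) - 2 * g' x| <= K) ->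
  `|g (x + s) - g (x - s) - 2 * s * g' x| <= K * s.
Proof.
move=> s0 dg Kg.
pose F u := g (x + u) - g (x - u) - u * (2 * g' x).
have dF (u : R) : is_derive u 1 F (g' (x + u) + g' (x - u) - 2 * g' x).
  have := is_derive_translate (dg (x + u)) => ?.
  have := is_derive_reflect (dg (x - u)) => ?.
  by apply: is_derive_eq; rewrite /GRing.scale /=; ring.
have -> : g (x + s) - g (x - s) - 2 * s * g' x = F s - F 0.
  by rewrite /F addr0 subr0 mul0r subr0; ring.
have := mean_value_ineq s0 (fun u _ => dF u) Kg.
by rewrite subr0.
Qed.

Lemma is_derive_affine_inv (k c c' y : R) : c - y != 0 ->
  is_derive y 1 (fun z : R => c' + k * (c - z)^-1) (k * (c - y) ^- 2).
Proof.
move=> d0.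
have h : is_derive y 1 (cst c - id) (- 1 : R).
  by apply: is_derive_eq; rewrite sub0r.
have hV := @is_deriveV _ (cst c - id) y (- 1) 1 d0 h.
have := is_deriveD (is_derive_cst c' y 1) (is_deriveZ k hV).
set d := (X in is_derive _ _ _ X) => H.
suff <- : d = k * (c - y) ^- 2 by exact: H.
by rewrite /d add0r /GRing.scale /= mulrN1 opprK.
Qed.

(** A positive excess z - eps would be multiplied by exp(th T) over a length T,
which is at least (th T)^2 / 4 and so outgrows every affine function.  This is
what selects the bounded solution of the constant-coefficient equation. *)
Lemma linear_growth_comparison (z dz : R -> R) (th eps K c : R) : 0 < th ->
  (forall x : R, c <= x -> is_derive x 1 z (dz x)) ->
  (forall x, c <= x -> th * (z x - eps) <= dz x) ->
  (forall x, c <= x -> `|z x| <= K * (1 + `|x|)) -> z c <= eps.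
Proof.
move=> th0 dzP dzle zK; rewrite leNgt; apply/negP => epsz.
pose F x := (eps - z x) * expR (- th * x).
have dF (x : R) : c <= x ->
    is_derive x 1 F ((th * (z x - eps) - dz x) * expR (- th * x)).
  move=> cx; have := dzP x cx => ?.
  have : is_derive x 1 (fun y : R => expR (- th * y)) (- th * expR (- th * x)).
    have h : is_derive x 1 (fun y : R => - th * y) (- th).
      by apply: is_derive_eq; rewrite /GRing.scale /= ?mulr0 ?addr0 mulr1.
    by have := is_derive1_comp (is_derive_expR (- th * x)) h; rewrite mulrC.
  by move=> ?; apply: is_derive_eq; rewrite /GRing.scale /=; ring.
have K0 : 0 <= K * (1 + `|c|) by apply: le_trans (zK c (lexx c)).
have {}K0 : 0 <= K.
  by move: K0; rewrite pmulr_lge0//; have := normr_ge0 c; lra.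
(* eta is the excess at c; key bounds it by a quantity linear in 1/T *)
pose eta := z c - eps; have eta0 : 0 < eta by rewrite subr_gt0.
pose K' := K * (2 + `|c|) + `|eps|.
have K'0 : 0 <= K' by rewrite addr_ge0// mulr_ge0// addr_ge0.
have key T : 1 <= T -> eta * (th ^+ 2 * T / 4) <= K' .
  move=> T1; have T0 : 0 <= T by lra.
  have cT : c <= c + T by lra.
  have : F (c + T) <= F c.
    apply: (is_derive_nonincreasing (F' := fun x => (th * (z x - eps) - dz x) * expR (- th * x)) cT).
      by move=> x /andP[cx _]; exact: dF.
    move=> x /andP[cx _]; rewrite mulr_le0_ge0 ?expR_ge0// subr_le0; exact: dzle.
  rewrite /F -(ler_pM2r (expR_gt0 (th * (c + T)))) -!mulrA -!expRD.
  rewrite (_ : - th * (c + T) + th * (c + T) = 0); last ring.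
  rewrite (_ : - th * c + th * (c + T) = th * T); last ring.
  rewrite expR0 mulr1 => h.
  have h2 : eta * expR (th * T) <= z (c + T) - eps by rewrite /eta; lra.
  have : eta * (th ^+ 2 * T ^+ 2 / 4) <= eta * expR (th * T).
    rewrite ler_pM2l//.
    have -> : th * T = th * T / 2 + th * T / 2 by field.
    rewrite expRD; have := expR_ge1Dx (th * T / 2).
    have : 0 <= th * T by rewrite mulr_ge0// ltW.
    set u := th * T; set w := expR _ => u0 w1.
    have -> : th ^+ 2 * T ^+ 2 / 4 = (u / 2) * (u / 2) by rewrite /u; field.
    by apply: ler_pM; lra.
  move=> h3.
  have := zK _ cT.
  have : `|c + T| <= `|c| + T by rewrite (le_trans (ler_normD _ _))// (ger0_norm T0).
  move=> h4 h5.
  have h6 : z (c + T) <= K * (1 + (`|c| + T)).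
    apply: le_trans (ler_norm _) _; apply: le_trans h5 _.
    by rewrite ler_wpM2l// lerD2l.
  have h7 : - eps <= `|eps| by rewrite -normrN ler_norm.
  have h8 : z (c + T) - eps <= K' * T.
    rewrite /K'; have := normr_ge0 c; have := normr_ge0 eps.
    move: (`|c|) (`|eps|) K0 T1 h6 h7 => C EE K0 T1 h6 h7 EE0 C0.
    have a1 : EE <= EE * T by rewrite ler_peMr.
    have a2 : K * (1 + (C + T)) <= K * ((2 + C) * T).
      by rewrite ler_wpM2l//; nra.
    by lra.
  have : eta * (th ^+ 2 * T / 4) * T <= K' * T.
    apply: le_trans h8; apply: le_trans h2; apply: le_trans h3.
    by rewrite le_eqVlt; apply/orP; left; apply/eqP; ring.
  by rewrite ler_pM2r//; lra.
have e0 : 0 < eta * th ^+ 2 by rewrite mulr_gt0// exprn_gt0.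
have := key (1 + 4 * K' / (eta * th ^+ 2)).
have -> : eta * (th ^+ 2 * (1 + 4 * K' / (eta * th ^+ 2)) / 4) =
          eta * th ^+ 2 / 4 + K'.
  by field; rewrite !gt_eqF.
have q0 : 0 <= 4 * K' / (eta * th ^+ 2).
  by apply: divr_ge0; [rewrite mulr_ge0|exact: ltW].
have q1 : 1 <= 1 + 4 * K' / (eta * th ^+ 2) by lra.
by move=> /(_ q1); lra.
Qed.

End mean_value.


(** * Stationarity and detailed balance *)

Lemma nneseries_EFin_cvg {R : realType} (u : nat -> R) (v : R) :
  (forall j, 0 <= u j) -> (\sum_(j <oo) (u j)%:E = v%:E)%E ->
  \sum_(j < N) u j @[N --> \oo] --> v.
Proof.
move=> u0 uv; have : cvgn (eseries (EFin \o u)).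
  by apply: is_cvg_nneseries => j _ _ /=; rewrite lee_fin.
move=> /cvg_ex[l hl]; have lv : l = v%:E.
  by rewrite -uv; apply/esym/cvg_lim.
move: hl; rewrite lv => /fine_cvgP[_]; apply: cvg_trans.
by apply: near_eq_cvg; apply: nearW => N; rewrite /= /eseries /= sumEFin big_mkord.
Qed.

Lemma nneseries_EFin_ub {R : realType} (u : nat -> R) (v : R) :
  (forall j, 0 <= u j) -> (\sum_(j <oo) (u j)%:E = v%:E)%E ->
  forall N, \sum_(j < N) u j <= v.
Proof.
move=> u0 uv N; apply: (cvgr_to_ge (nneseries_EFin_cvg u0 uv)).
near=> M; rewrite -!(big_mkord predT).
rewrite [X in _ <= X](@big_cat_nat _ _ _ N)//=; last by near: M; exists N.
by rewrite lerDl sumr_ge0.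
Unshelve. all: by end_near. Qed.

Lemma nneseries_EFin_term {R : realType} (u : nat -> R) (v : R) :
  (forall j, 0 <= u j) -> (\sum_(j <oo) (u j)%:E = v%:E)%E ->
  forall j, u j <= v.
Proof.
move=> u0 uv j; apply: le_trans (nneseries_EFin_ub u0 uv j.+1).
by rewrite big_ord_recr /= lerDr sumr_ge0.
Qed.

Lemma bernoulli_ineq {R : realType} (y : R) N : 0 <= y <= 1 ->
  1 - N%:R * y <= (1 - y) ^+ N.
Proof.
move=> /andP[y0 y1]; elim: N => [|N IH]; first by rewrite mul0r subr0 expr0.
rewrite exprS; apply: (@le_trans _ _ ((1 - y) * (1 - N%:R * y))); last first.
  by rewrite ler_wpM2l//; lra.
have : 0 <= N%:R * (y * y) by rewrite !mulr_ge0.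
by rewrite -natr1; lra.
Qed.

Section transition.
Context {R : realType}.
Variables (p : R -> nat -> nat -> R) (q : nat -> nat -> R).
Hypotheses (tp : transition_function p) (rp : has_rates p q).

Lemma transition_ge0 t i j : 0 <= t -> 0 <= p t i j.
Proof. by case: tp => + _ _ _; apply. Qed.

Lemma transition_offdiag t i j : 0 <= t -> i != j -> p t i j <= 1 - p t i i.
Proof.
move=> t0 ij; case: tp => p0 p1 _ _.
have := nneseries_EFin_ub (fun k => p0 t i k t0) (p1 t i t0) (maxn i j).+1.
have ii : (i < (maxn i j).+1)%N by rewrite ltnS leq_maxl.
have jj : (j < (maxn i j).+1)%N by rewrite ltnS leq_maxr.
rewrite (bigD1 (Ordinal ii))//= (bigD1 (Ordinal jj))/=; last first.
  by rewrite -val_eqE /= eq_sym.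
have : 0 <= \sum_(k < (maxn i j).+1 | (k != Ordinal ii) && (k != Ordinal jj)) p t i k.
  by apply: sumr_ge0 => k _; exact: p0.
lra.
Qed.

Lemma transition_diag_exp t i N : 0 <= t -> p t i i ^+ N <= p (N%:R * t) i i.
Proof.
case: tp => p0 p1 pe pck t0; elim: N => [|N IH].
  by rewrite mul0r pe eqxx.
have Nt : 0 <= N%:R * t by rewrite mulr_ge0.
rewrite -natr1 mulrDl mul1r exprSr.
apply: (@le_trans _ _ (p (N%:R * t) i i * p t i i)).
  by rewrite ler_wpM2r// p0.
have h := pck _ _ i i Nt t0.
apply: (nneseries_EFin_term _ h i) => j.
by rewrite mulr_ge0// p0.
Qed.

(** Supermultiplicativity gives p_t(i,i) >= p_(t/N)(i,i)^N, the rate gives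
p_(t/N)(i,i) >= 1 - Q t / N for large N, and Bernoulli's inequality turns the
power into a bound that is linear in t and uniform over the states of rate less
than Q.  This uniformity is what allows differentiating the stationarity
equation under the sum. *)
Lemma transition_diag_ge i (Q t : R) : 0 < Q -> - q i i < Q -> 0 <= t ->
  1 - Q * t <= p t i i.
Proof.
move=> Q0 qQ; rewrite le_eqVlt => /predU1P[<-|t0].
  by case: tp => _ _ -> _; rewrite eqxx mulr0 subr0.
have [eta /= eta0 H] : \forall s \near 0^'+, 1 - Q * s <= p s i i.
  have : - Q < q i i by lra.
  move=> /(cvgr_gt _ (@rp i i))[eta eta0 H].
  exists eta => // s /= se s0; have /= := H s se s0.
  rewrite eqxx mulr1n ltr_pdivlMr//; lra.
pose N := (Num.truncn (t / eta + Q * t)).+1.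
have NN : t / eta + Q * t < N%:R by rewrite truncnS_gt.
have N0 : 0 < N%:R :> R by [].
have te0 : 0 < t / eta by rewrite divr_gt0.
have Qt0 : 0 < Q * t by rewrite mulr_gt0.
have tN : 0 < t / N%:R by rewrite divr_gt0.
have : 1 - Q * (t / N%:R) <= p (t / N%:R) i i.
  apply: H => //=; rewrite sub0r normrN gtr0_norm//.
  by rewrite ltr_pdivrMr// mulrC -ltr_pdivrMr//; lra.
have y01 : 0 <= Q * (t / N%:R) <= 1.
  apply/andP; split; first by rewrite ltW// mulr_gt0.
  by rewrite mulrA ler_pdivrMr//; lra.
have := bernoulli_ineq N y01.
have -> : N%:R * (Q * (t / N%:R)) = Q * t by field; rewrite gt_eqF.
move=> h1 h2.
have := transition_diag_exp i N (ltW tN).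
have -> : N%:R * (t / N%:R) = t by field; rewrite gt_eqF.
apply: le_trans; apply: le_trans h1 _; apply: lerXn2r => //.
- by rewrite nnegrE; lra.
- by rewrite nnegrE transition_ge0// ltW.
Qed.

Variable m : nat -> R.
Hypotheses (m_ge0 : forall i, 0 <= m i)
  (m_sum : \sum_(i < N) m i @[N --> \oo] --> (1 : R))
  (m_stat : forall (t : R) j, 0 <= t ->
     \sum_(i < N) m i * p t i j @[N --> \oo] --> m j).

(** Truncate the stationarity equation at N: the discarded states enter j
within time t with probability at most Q t each, so dividing by t and letting t
tend to 0 loses at most Q times the discarded mass. *)
Lemma stationary_flow_bounds (Q : R) j N : 0 < Q ->
  (forall i, - q i i < Q) -> (j < N)%N ->
  - (Q * (1 - \sum_(i < N) m i)) <= \sum_(i < N) m i * q i j <= 0.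
Proof.
move=> Q0 qQ jN.
have lim : (\sum_(i < N) m i * ((p t i j - (i == j :> nat)%:R) / t)) @[t --> 0^'+]
    --> \sum_(i < N) m i * q i j.
  apply: cvg_big => [|i _]; first exact: add_continuous.
  by apply: cvgM; [exact: cvg_cst|exact: rp].
have key (t : R) : 0 < t -> - (Q * (1 - \sum_(i < N) m i)) <=
   \sum_(i < N) m i * ((p t i j - (i == j :> nat)%:R) / t) <= 0.
  move=> t0.
  have -> : \sum_(i < N) m i * ((p t i j - (i == j :> nat)%:R) / t) =
      (\sum_(i < N) m i * p t i j - m j) / t.
    rewrite mulrBl mulr_suml.
    rewrite [m j](_ : _ = \sum_(i < N) m i * (i == j :> nat)%:R); last first.
      rewrite (bigD1 (Ordinal jN))//= eqxx mulr1 big1 ?addr0// => k kj.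
      rewrite (_ : (k == j :> nat) = false) ?mulr0//.
      by apply: contraNF kj => /eqP kj; apply/eqP/val_inj.
    rewrite mulr_suml -sumrB; apply: eq_bigr => i _; ring.
  rewrite ler_pdivlMr// ler_pdivrMr// mul0r.
  have mon : {homo (fun M => \sum_(i < M) m i * p t i j) : a b / (a <= b)%N >-> a <= b}.
    move=> a b ab; rewrite -!(big_mkord predT (fun i => m i * p t i j)).
    rewrite [X in _ <= X](@big_cat_nat _ _ _ a)//= lerDl sumr_ge0// => k _.
    by rewrite mulr_ge0// transition_ge0// ltW.
  apply/andP; split; last first.
    rewrite subr_le0.

    apply: (cvgr_to_ge (@m_stat t j (ltW t0))).
    by exists N => // M /= NM; exact: mon.
  suff : m j <= \sum_(i < N) m i * p t i j + Q * t * (1 - \sum_(i < N) m i).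
    by lra.
  apply: (cvgr_to_le (@m_stat t j (ltW t0))).
  exists N => // M /= NM; rewrite -(subnKC NM) big_split_ord /= lerD2l.
  apply: (@le_trans _ _ (Q * t * \sum_(i < M - N) m (N + i)%N)).
    rewrite mulr_sumr ler_sum// => i _; rewrite [X in _ <= X]mulrC ler_wpM2l//.
    have ij : (N + i)%N != j by rewrite gtn_eqF// ltn_addr.
    have := transition_offdiag (ltW t0) ij.
    have := transition_diag_ge Q0 (qQ (N + i)%N) (ltW t0); lra.
  apply: ler_wpM2l; first by rewrite ltW// mulr_gt0.
  suff : \sum_(i < M) m i <= 1.
    have -> : \sum_(i < M) m i = \sum_(i < N) m i + \sum_(i < M - N) m (N + i)%N.
      by rewrite -[in LHS](subnKC NM) big_split_ord.
    by lra.
  apply: (cvgr_to_ge m_sum); exists M => // M' /= MM'.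
  rewrite -!(big_mkord predT m) [X in _ <= X](@big_cat_nat _ _ _ M)//=.
  by rewrite lerDl sumr_ge0.
apply/andP; split.
- apply: (cvgr_to_ge lim); near=> t.
  have t0 : 0 < t by near: t; exact: nbhs_right_gt.
  by case/andP: (key t t0).
- apply: (cvgr_to_le lim); near=> t.
  have t0 : 0 < t by near: t; exact: nbhs_right_gt.
  by case/andP: (key t t0).
Unshelve. all: by end_near. Qed.

End transition.

(** Global balance at state j involves finitely many states; by induction on j
the flow across each edge of the line is balanced separately. *)
Lemma birth_death_detailed_balance {R : realType} (p : R -> nat -> nat -> R)
    (birth death : nat -> R) (Q : R) (m : nat -> R) :
  transition_function p -> has_rates p (birth_death_rates birth death) ->
  (forall k, birth k + death k < Q) -> 0 < Q -> death 0%N = 0 ->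
  (forall i, 0 <= m i) -> \sum_(i < N) m i @[N --> \oo] --> (1 : R) ->
  (forall t j, 0 <= t -> \sum_(i < N) m i * p t i j @[N --> \oo] --> m j) ->
  forall k, birth k * m k = death k.+1 * m k.+1.
Proof.
move=> tp rp bdQ Q0 d0 m0 m1 ms.
set q := birth_death_rates birth death in rp.
have qii i : - q i i < Q.
  by rewrite /q /birth_death_rates ltn_eqF// eqxx opprK.
have tail0 j N : \sum_(i < j.+2 + N) m i * q i j = \sum_(i < j.+2) m i * q i j.
  rewrite big_split_ord /= [X in _ + X]big1 ?addr0// => i _.
  rewrite /q /birth_death_rates !ifF ?mulr0//; apply/eqP; lia.
have bal j : \sum_(i < j.+2) m i * q i j = 0.
  apply/eqP; rewrite eq_le; apply/andP; split.
    by have /andP[] := stationary_flow_bounds tp rp m0 m1 ms Q0 qii (leqnSn j.+1).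
  have h N : - (Q * (1 - \sum_(i < j.+2 + N) m i)) <= \sum_(i < j.+2) m i * q i j.
    rewrite -(tail0 j N).
    have jN : (j < j.+2 + N)%N by rewrite ltn_addr.
    by have /andP[] := stationary_flow_bounds tp rp m0 m1 ms Q0 qii jN.
  have c : - (Q * (1 - \sum_(i < j.+2 + N) m i)) @[N --> \oo] --> - (Q * (1 - 1)).
    apply: cvgN; apply: cvgM; first exact: cvg_cst.
    apply: cvgB; first exact: cvg_cst.
    have := m1; rewrite -(cvg_shiftn j.+2).
    by under eq_fun do rewrite addnC.
  rewrite [X in X <= _](_ : _ = - (Q * (1 - 1))); last by rewrite subrr mulr0 oppr0.
  by apply: (cvgr_to_le c); exact: nearW.
elim=> [|k IH].
  have := bal 0%N; rewrite !big_ord_recr big_ord0 /= /q /birth_death_rates /=.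
  by rewrite d0; lra.
have := bal k.+1; rewrite !big_ord_recr /= big1; last first.
  move=> i _; have ik := ltn_ord i; rewrite /q /birth_death_rates.
  by rewrite !ifF ?mulr0//; apply/eqP; lia.
rewrite /q /birth_death_rates !eqxx.
rewrite (_ : (k.+1 == k.+2) = false); last by apply/eqP; lia.
rewrite (_ : (k.+1 == k.+3) = false); last by apply/eqP; lia.
move: IH; lra.
Qed.

(** * Moments of the Erlang-C chain *)

Section erlang_chain.
Context {R : realType}.
Variables (de be : R) (n : nat) (x m : nat -> R).
Hypotheses (de0 : 0 < de) (de1 : de <= 1) (be0 : 0 < be).
Hypotheses (x0 : x 0%N = - de^-1) (xS : forall k, x k.+1 = x k + de).
Hypothesis xn : x n = be.
Hypotheses (m_ge0 : forall k, 0 <= m k).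
Hypothesis m_le1 : forall N, \sum_(k < N) m k <= 1.
Hypothesis m_balance :
  forall k, m k = (1 + de * Num.min (x k.+1) be) * m k.+1.

(** Death rate over birth rate: e k is min(k, n) / R in the original scale. *)
Let e k := 1 + de * Num.min (x k) be.

Ltac params := move: (de0) (de1) (be0) => ? ? ?.

Lemma grid_lt i j : (i < j)%N -> x i + de <= x j.
Proof.
elim: j => // j IH; rewrite ltnS leq_eqVlt => /orP[/eqP->|/IH].
  by rewrite xS.
by params; rewrite xS => h; lra.
Qed.

Lemma grid_le i j : (i <= j)%N -> x i <= x j.
Proof.
rewrite leq_eqVlt => /orP[/eqP->//|/grid_lt]; params; lra.
Qed.

Lemma grid_ge0 k : - de^-1 <= x k.
Proof. by rewrite -x0 grid_le. Qed.

(** Detailed balance is m_k e_k = m_(k-1), so the sum telescopes.  The value of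
F below the grid is harmless because e_0 = 0. *)
Lemma sum_stein (F : R -> R) N :
  \sum_(k < N.+1) m k * (F (x k) - e k * F (x k - de)) = m N * F (x N).
Proof.
params.
elim: N => [|N IH].
  rewrite big_ord_recl big_ord0 addr0 /e x0 min_l; last first.
    have : 0 < de^-1 by rewrite invr_gt0.
    lra.
  rewrite mulrN divff ?gt_eqF//; ring.
rewrite big_ord_recr IH /= m_balance -/(e N.+1) xS.
rewrite (_ : x N + de - de = x N); last ring.
ring.
Qed.

(** [sum_stein] for F(x) = x + delta: the summand is delta (1 - x^2), and the
boundary term has the favourable sign. *)
Lemma left_mean_square :
  \sum_(k < n.+1) m k * x k ^+ 2 <= \sum_(k < n.+1) m k.
Proof.
params.
have := sum_stein (fun t => t + de) n.
rewrite (eq_bigr (fun k : 'I_n.+1 => de * (m k - m k * x k ^+ 2))); last first.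
  move=> [k /= kn] _; have xk : x k <= be by rewrite -xn grid_le.
  by rewrite /e (min_l xk); ring.
rewrite -mulr_sumr sumrB xn => h.
rewrite -subr_ge0 -(pmulr_rge0 _ de0) h mulr_ge0//; lra.
Qed.

(** [sum_stein] for F(x) = (x + delta)^3. *)
Lemma left_fourth_moment_eq :
  de * \sum_(k < n.+1) m k * (x k ^+ 4 - 3 * x k ^+ 2 - 3 * de * x k - de ^+ 2)
  = - (m n * (be + de) ^+ 3).
Proof.
have := sum_stein (fun t => (t + de) ^+ 3) n.
rewrite xn => <-; rewrite mulr_sumr -sumrN; apply: eq_bigr => -[k /= kn] _.
have xk : x k <= be by rewrite -xn grid_le.
by rewrite /e (min_l xk); ring.
Qed.

Lemma left_fourth_moment_boundary :
  \sum_(k < n.+1) m k * x k ^+ 4 + de^-1 * (m n * (be + de) ^+ 3)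
  <= 7 * \sum_(k < n.+1) m k.
Proof.
params.
have id : \sum_(k < n.+1) m k * x k ^+ 4 + de^-1 * (m n * (be + de) ^+ 3) =
  \sum_(k < n.+1) m k * (3 * x k ^+ 2 + 3 * de * x k + de ^+ 2).
  have := left_fourth_moment_eq => /(congr1 (fun t => - (de^-1 * t))).
  rewrite mulKf ?gt_eqF// mulrN opprK => <-.
  rewrite -sumrN -big_split /=; apply: eq_bigr => k _; ring.
rewrite id.
apply: (@le_trans _ _
  (\sum_(k < n.+1) (9/2 * (m k * x k ^+ 2) + 5/2 * m k))).
  apply: ler_sum => k _.
  have : 3 * x k ^+ 2 + 3 * de * x k + de ^+ 2 <= 9/2 * x k ^+ 2 + 5/2.
    have : 0 <= (x k - de) ^+ 2 by exact: sqr_ge0.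
    have : de ^+ 2 <= 1 by rewrite expr_le1// ltW.
    by nra.
  by move=> /(ler_wpM2l (m_ge0 k)); lra.
rewrite big_split /= -!mulr_sumr; have := left_mean_square; lra.
Qed.

(** The boundary term of the fourth moment identity is itself bounded by that
identity; this gives the mass at n a factor delta and cubic decay in beta. *)
Lemma boundary_mass_tail : m n * (be + de) ^+ 3 <= 7 * de.
Proof.
params.
have := left_fourth_moment_boundary.
have : 0 <= \sum_(k < n.+1) m k * x k ^+ 4.
  by apply: sumr_ge0 => k _; rewrite mulr_ge0// exprn_even_ge0.
have := m_le1 n.+1 => h1 h2 h3.
have : de^-1 * (m n * (be + de) ^+ 3) <= 7 by lra.
by rewrite mulrC ler_pdivrMr.
Qed.

(** Both sides carry the mass of the left part, not 1: in heavy traffic that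
mass is of order beta, and this factor is needed later. *)
Lemma left_cubic_moment :
  \sum_(k < n.+1) m k * (1 + `|x k|) ^+ 3 <= 20 * \sum_(k < n.+1) m k.
Proof.
params.
apply: (@le_trans _ _
  (\sum_(k < n.+1) (4 * m k + 2 * (m k * x k ^+ 2) + 2 * (m k * x k ^+ 4)))).
  apply: ler_sum => k _.
  have : (1 + `|x k|) ^+ 3 <= 4 + 2 * x k ^+ 2 + 2 * x k ^+ 4.
    have -> : x k ^+ 4 = `|x k| ^+ 4 by rewrite -normrX ger0_norm// exprn_even_ge0.
    have -> : x k ^+ 2 = `|x k| ^+ 2 by rewrite -normrX ger0_norm// sqr_ge0.
    have := normr_ge0 (x k); set u := `|x k| => u0.
    have : 0 <= u ^+ 2 * (u - 1) ^+ 2 by rewrite mulr_ge0// sqr_ge0.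
    have : 0 <= (u + 1) * (u - 1) ^+ 2 by rewrite mulr_ge0// ?sqr_ge0//; lra.
    by nra.
  by move=> /(ler_wpM2l (m_ge0 k)); lra.
rewrite !big_split /= -!mulr_sumr.
have h : 0 <= de^-1 * (m n * (be + de) ^+ 3).
  by apply: mulr_ge0; [rewrite invr_ge0 ltW|rewrite mulr_ge0// exprn_ge0//; lra].
have := left_mean_square; have := left_fourth_moment_boundary; lra.
Qed.

(** [sum_stein] for F(x) = x + delta, now across the kink at be. *)
Lemma right_first_moment N : (n <= N)%N ->
  \sum_(k < N.+1) m k * (Num.min (x k) be * x k) <= 1.
Proof.
params.
move=> nN; have := sum_stein (fun t => t + de) N.
rewrite (eq_bigr (fun k : 'I_N.+1 =>
    de * (m k - m k * (Num.min (x k) be * x k)))); last first.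
  by move=> [k /= kn] _; rewrite /e; ring.
rewrite -mulr_sumr sumrB => h.
apply: le_trans (m_le1 N.+1).
rewrite -subr_ge0 -(pmulr_rge0 _ de0) h mulr_ge0//.
by have := grid_le nN; rewrite xn; lra.
Qed.

Lemma first_moment N : be * \sum_(k < N) m k * `|x k| <= 1 + 2 * be * (de^-1 + be).
Proof.
params.
wlog nN : N / (n < N)%N.
  move=> H; have [/H//|Nn] := ltnP n N.
  apply: le_trans (H _ (ltnSn n)); rewrite ler_pM2l//.
  rewrite -(big_mkord predT (fun k => m k * `|x k|)).
  rewrite -(big_mkord predT (fun k => m k * `|x k|)).
  rewrite [in X in _ <= X](@big_cat_nat _ _ _ N)//=; last exact: leqW.
  by rewrite lerDl sumr_ge0// => k _; rewrite mulr_ge0.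
case: N nN => // N; rewrite ltnS => nN.
have h := right_first_moment nN; rewrite mulr_sumr.
have d0 : 0 < de^-1 by rewrite invr_gt0.
apply: (@le_trans _ _ (\sum_(k < N.+1) (m k * (Num.min (x k) be * x k)
    + (2 * be * (de^-1 + be)) * m k))); last first.
  rewrite big_split /= -mulr_sumr; have := m_le1 N.+1.
  move=> h1; rewrite lerD//; have : 0 <= 2 * be * (de^-1 + be) by nra.
  move=> /ler_wpM2l => /(_ _ _ h1); lra.
apply: ler_sum => k _.
have : be * `|x k| <= Num.min (x k) be * x k + 2 * be * (de^-1 + be).
  have [xb|/ltW xb] := leP (x k) be.
    have := grid_ge0 k; have [x0'|x0'] := ler0P (x k); nra.
  rewrite ger0_norm; nra.
by move=> /(ler_wpM2l (m_ge0 k)); lra.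
Qed.

Lemma weighted_mass_bounded : exists K : R, forall N, \sum_(k < N) m k * (1 + `|x k|) <= K.
Proof.
params.
exists (1 + be^-1 * (1 + 2 * be * (de^-1 + be))) => N.
under eq_bigr do rewrite mulrDr mulr1.
rewrite big_split /= lerD ?m_le1// mulrC ler_pdivlMr// mulrC first_moment//.
Qed.

Lemma cvg_weighted_mass_sum : cvgn (series (fun k => m k * (1 + `|x k|))).
Proof.
have [K HK] := weighted_mass_bounded.
apply: nondecreasing_is_cvgn.
  by apply: nondecreasing_series => k _ _; rewrite mulr_ge0// addr_ge0.
by exists K => _ [N _ <-]; rewrite /series /= big_mkord.
Qed.

Lemma cvg_weighted_mass : m k * (1 + `|x k|) @[k --> \oo] --> 0.
Proof. exact: (cvg_series_cvg_0 cvg_weighted_mass_sum). Qed.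

Lemma cvg_mass : m k @[k --> \oo] --> 0.
Proof.
params.
apply: (@squeeze_cvgr _ _ _ _ (cst 0) (fun k => m k * (1 + `|x k|))) => //.
- apply: nearW => k; rewrite m_ge0 /= ler_peMr//; have := normr_ge0 (x k); lra.
- exact: cvg_cst.
- exact: cvg_weighted_mass.
Qed.

(** Right of n the weights satisfy (1 + delta beta) m_(k+1) = m_k; summing,
m_n is delta beta times the mass right of n. *)
Lemma boundary_mass_le : m n <= de * be.
Proof.
params.
have tel N : m n = m (n + N)%N + de * be * \sum_(k < N) m (n + k.+1)%N.
  elim: N => [|N IH]; first by rewrite big_ord0 addn0 mulr0 addr0.
  rewrite big_ord_recr /= {1}IH m_balance -addnS min_r.
    by ring.
  by rewrite -xn grid_le// leq_addr.
have bd N : m n - de * be <= m (n + N)%N.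
  rewrite (tel N) -addrA gerDl subr_le0.
  apply: ler_piMr; first by rewrite ltW ?mulr_gt0.
  apply: le_trans (m_le1 (n.+1 + N)); rewrite big_split_ord /=.
  rewrite [X in _ <= _ + X](eq_bigr (fun k : 'I_N => m (n + k.+1)%N)); last first.
    by move=> k _; rewrite addSnnS.
  by rewrite lerDr sumr_ge0.
rewrite -subr_le0.
have sh : m (n + N)%N @[N --> \oo] --> 0.
  under eq_fun do rewrite addnC.
  by have := cvg_mass; rewrite -(cvg_shiftn n m).
by apply: (cvgr_to_ge sh); apply: nearW.
Qed.

(** [sum_stein] for F(x) = 1 / (3/2 - x).  This F is positive, bounded by 2 at
be <= 1, and its summand is at least delta / 8: the numerator
1 - x (3/2 - x) has negative discriminant.  Hence the mass of the left part is
at most 16 m_n / delta. *)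
Lemma left_mass : be <= 1 -> \sum_(k < n.+1) m k <= 16 * be.
Proof.
params; move=> b1.
have := sum_stein (fun t => (3 / 2 - t)^-1) n; rewrite xn => h.
have pt (k : 'I_n.+1) : de / 8 * m k <=
    m k * ((3 / 2 - x k)^-1 - e k * (3 / 2 - (x k - de))^-1).
  case: k => k /= kn; have xk : x k <= be by rewrite -xn grid_le.
  rewrite mulrC ler_wpM2l// /e (min_l xk).
  have a0 : 0 < 3 / 2 - x k by lra.
  have a1 : 0 < 3 / 2 - (x k - de) by lra.
  have -> : (3 / 2 - x k)^-1 - (1 + de * x k) * (3 / 2 - (x k - de))^-1 =
     de * (1 - x k * (3 / 2 - x k)) / ((3 / 2 - x k) * (3 / 2 - (x k - de))).
    by field; do ?[apply/andP; split]; apply: lt0r_neq0; lra.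
  rewrite ler_pdivlMr ?mulr_gt0// -mulrA ler_pM2l//.
  have : 0 <= (x k - 4 / 7) ^+ 2 by exact: sqr_ge0.
  nra.
have : de / 8 * \sum_(k < n.+1) m k <= 2 * (de * be).
  rewrite mulr_sumr; apply: le_trans (ler_sum _ (fun k _ => pt k)) _.
  rewrite h mulrC; apply: ler_pM => //.
  - by rewrite invr_ge0; lra.
  - by rewrite invf_ple ?posrE//; lra.
  - exact: boundary_mass_le.
move=> h2; rewrite -(ler_pM2l de0); lra.
Qed.

End erlang_chain.

(** * The Stein equation of the diffusion *)

Section stein_solution.
Context {R : realType}.
Variables (de be : R).
Hypotheses (de0 : 0 < de) (de1 : de <= 1) (be0 : 0 < be).

(** The coefficients of the diffusion in the time scale where mu = 1. *)
Definition stein_drift (x : R) : R := - Num.min x be.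

Definition stein_diffusion (x : R) : R :=
  2 + de * Num.max (- de^-1) (Num.min x be).

Local Notation a := stein_diffusion.
Local Notation b := stein_drift.

Ltac params := move: (de0) (de1) (be0) => ? ? ?.

Lemma stein_diffusion_ge1 x : 1 <= a x.
Proof.
rewrite /a; have : de * - de^-1 <= de * Num.max (- de^-1) (Num.min x be).
  by rewrite ler_pM2l// le_max lexx.
by rewrite mulrN divff ?gt_eqF//; lra.
Qed.

Lemma stein_diffusion_gt0 x : 0 < a x.
Proof. exact: lt_le_trans (stein_diffusion_ge1 x). Qed.

Lemma stein_diffusion_mid x : - de^-1 <= x -> x <= be -> a x = 2 + de * x.
Proof. by move=> x1 x2; rewrite /a (min_l x2) (max_r x1). Qed.

Lemma stein_diffusion_right x : be <= x -> a x = 2 + de * be.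
Proof.
move=> x1; rewrite /a (min_r x1) max_r//.
have : 0 < de^-1 by rewrite invr_gt0.
by params; lra.
Qed.

Lemma stein_diffusion_neg x : x <= 0 -> a x <= 2.
Proof.
move=> x0; rewrite /a gerDl pmulr_rle0// ge_max ge_min x0 andbT.
by rewrite oppr_le0 invr_ge0 ltW.
Qed.

Lemma stein_drift_left x : x <= be -> b x = - x.
Proof. by move=> h; rewrite /b min_l. Qed.

Lemma stein_drift_right x : be <= x -> b x = - be.
Proof. by move=> h; rewrite /b min_r. Qed.

Variable E : R -> R.
Hypotheses (E_gt0 : forall x, 0 < E x)
  (dE : forall x : R, is_derive x 1 E (2 * b x / a x * E x)).

(** E / a is proportional to the stationary density, so this is integration by
parts: the generator a psi' / 2 + b psi, weighted by the density, is an exact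
derivative. *)
Lemma is_derive_half_weight (psi : R -> R) (dpsi x : R) :
  is_derive x 1 psi dpsi ->
  is_derive x 1 (fun y => E y * psi y / 2) ((a x / 2 * dpsi + b x * psi x) * E x / a x).
Proof.
move=> dp; have ? := dE x.
have a0 : a x != 0 by rewrite gt_eqF// stein_diffusion_gt0.
apply: (@is_derive_eq _ _ _ (fun y => E y * psi y / 2)).
by rewrite !scaler0 add0r /GRing.scale /=; field.
Qed.

(** J is an antiderivative of r times the density.  Comparing the derivatives of
J and of E psi / 2 turns a differential inequality for psi into a bound of J by
E psi / 2, started from the end where J vanishes. *)
Section comparison.
Variables (J r : R -> R).
Hypothesis dJ : forall x : R, is_derive x 1 J (r x * E x / a x).

Lemma left_comparison (psi dpsi : R -> R) x0 :
  (J (- j%:R) @[j --> \oo] --> 0) ->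
  (forall x : R, x <= x0 -> is_derive x 1 psi (dpsi x)) ->
  (forall x, x <= x0 -> 0 <= psi x) ->
  (forall x, x <= x0 -> r x <= a x / 2 * dpsi x + b x * psi x) ->
  forall x, x <= x0 -> J x <= E x * psi x / 2.
Proof.
move=> J0 dpsiP psi0 rle x xx0; rewrite -subr_le0.
apply: (cvgr_to_ge J0); exists (Num.truncn (- x)).+1 => // j /= xj.
have jx : - j%:R <= x.
  rewrite lerNl; apply: le_trans (_ : (Num.truncn (- x)).+1%:R <= _); last by rewrite ler_nat.
  exact/ltW/truncnS_gt.
have jx0 := le_trans jx xx0.
apply: (@le_trans _ _ (J (- j%:R) - E (- j%:R) * psi (- j%:R) / 2)); last first.
  by rewrite gerBl divr_ge0// mulr_ge0// ?psi0// ltW.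
apply: (is_derive_nonincreasing (F := fun x => J x - E x * psi x / 2)
  (F' := fun x => r x * E x / a x - (a x / 2 * dpsi x + b x * psi x) * E x / a x) jx).
  move=> y /andP[_ yx]; have yx0 := le_trans yx xx0.
  have := is_derive_half_weight (dpsiP y yx0) => ?.
  have := dJ y => ?.
  exact: is_deriveB.
move=> y /andP[_ yx]; rewrite subr_le0 ler_pM2r ?invr_gt0 ?stein_diffusion_gt0//.
by rewrite ler_pM2r// rle// (le_trans yx).
Qed.

Lemma right_comparison_segment (psi dpsi : R -> R) x0 x1 : x0 <= x1 ->
  (forall x : R, x0 <= x <= x1 -> is_derive x 1 psi (dpsi x)) ->
  (forall x, x0 <= x <= x1 -> a x / 2 * dpsi x + b x * psi x <= r x) ->
  J x1 - E x1 * psi x1 / 2 <= 0 -> J x0 <= E x0 * psi x0 / 2.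
Proof.
move=> x01 dpsiP psile F1; rewrite -subr_le0; apply: le_trans F1.
rewrite -lerN2.
apply: (is_derive_nonincreasing (F := fun x => - (J x - E x * psi x / 2))
  (F' := fun x => - (r x * E x / a x - (a x / 2 * dpsi x + b x * psi x) * E x / a x)) x01).
  move=> y /dpsiP /is_derive_half_weight ?; have ? := dJ y.
  by apply: is_deriveN; exact: is_deriveB.
move=> y yx; rewrite oppr_le0 subr_ge0 ler_pM2r ?invr_gt0 ?stein_diffusion_gt0//.
by rewrite ler_pM2r// psile.
Qed.

Lemma right_comparison (psi dpsi : R -> R) x0 :
  (J j%:R @[j --> \oo] --> 0) ->
  (forall x : R, x0 <= x -> is_derive x 1 psi (dpsi x)) ->
  (forall x, x0 <= x -> 0 <= psi x) ->
  (forall x, x0 <= x -> a x / 2 * dpsi x + b x * psi x <= r x) ->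
  forall x, x0 <= x -> J x <= E x * psi x / 2.
Proof.
move=> J0 dpsiP psi0 psile x xx0; rewrite -subr_le0.
apply: (cvgr_to_ge J0); exists (Num.truncn x).+1 => // j /= xj.
have jx : x <= j%:R.
  apply: le_trans (_ : (Num.truncn x).+1%:R <= _); last by rewrite ler_nat.
  exact/ltW/truncnS_gt.
have jx0 := le_trans xx0 jx.
apply: (@le_trans _ _ (J j%:R - E j%:R * psi j%:R / 2)); last first.
  by rewrite gerBl divr_ge0// mulr_ge0// ?psi0// ltW.
rewrite -lerN2.
apply: (is_derive_nonincreasing (F := fun x => - (J x - E x * psi x / 2))
  (F' := fun x => - (r x * E x / a x - (a x / 2 * dpsi x + b x * psi x) * E x / a x)) jx).
  move=> y /andP[xy _]; have yx0 := le_trans xx0 xy.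
  have := is_derive_half_weight (dpsiP y yx0) => ?.
  have ? := dJ y.
  by apply: is_deriveN; exact: is_deriveB.
move=> y /andP[xy _]; rewrite oppr_le0 subr_ge0 ler_pM2r ?invr_gt0 ?stein_diffusion_gt0//.
by rewrite ler_pM2r// psile// (le_trans xx0).
Qed.

End comparison.

Section solution.
Variables (J r : R -> R).
Hypothesis dJ : forall x : R, is_derive x 1 J (r x * E x / a x).
Hypotheses (JNy : J (- j%:R) @[j --> \oo] --> 0) (Jy : J j%:R @[j --> \oo] --> 0).

(** Variation of constants for a g' / 2 + b g = r. *)
Definition stein_sol x := 2 * J x / E x.
Local Notation g := stein_sol.
Definition stein_sol' x := 2 / a x * (r x - b x * g x).
Local Notation g' := stein_sol'.

Lemma is_derive_stein_sol (x : R) : is_derive x 1 g (g' x).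
Proof.
have ? := dJ x; have ? := dE x.
have E0 : E x != 0 by rewrite gt_eqF.
have a0 : a x != 0 by rewrite gt_eqF// stein_diffusion_gt0.
have ? : is_derive x 1 (fun y => (E y)^-1) (- (E x) ^- 2 *: (2 * b x / a x * E x)).
  by apply: is_deriveV.
apply: (@is_derive_eq _ _ _ (fun y => 2 * J y * (E y)^-1)).
rewrite /g' /g /GRing.scale /=; field.
by rewrite E0 a0.
Qed.

Lemma stein_equation x : a x / 2 * g' x = r x - b x * g x.
Proof.
have a0 : a x != 0 by rewrite gt_eqF// stein_diffusion_gt0.
by rewrite /g'; field.
Qed.

Let dNJ (x : R) : is_derive x 1 (fun y => - J y) ((- r x) * E x / a x).
Proof. by rewrite !mulNr; have ? := dJ x; exact: is_deriveN. Qed.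

Lemma stein_sol_norm_le (psi : R -> R) x :
  J x <= E x * psi x / 2 -> - J x <= E x * psi x / 2 -> `|g x| <= psi x.
Proof.
move=> h1 h2; have e0 := E_gt0 x.
rewrite /g normrM normfV (gtr0_norm e0) ler_pdivrMr// normrM gtr0_norm//.
have : `|J x| <= E x * psi x / 2 by rewrite ler_norml; apply/andP; split; lra.
lra.
Qed.

Lemma stein_sol_left_bound (psi dpsi : R -> R) x0 :
  (forall x : R, x <= x0 -> is_derive x 1 psi (dpsi x)) ->
  (forall x, x <= x0 -> 0 <= psi x) ->
  (forall x, x <= x0 -> `|r x| <= a x / 2 * dpsi x + b x * psi x) ->
  forall x, x <= x0 -> `|g x| <= psi x.
Proof.
move=> dpsiP psi0 rle x xx0; apply: stein_sol_norm_le.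
  apply: (left_comparison dJ JNy dpsiP) => // y yx0.
  exact: le_trans (ler_norm _) (rle y yx0).
apply: (left_comparison (r := fun x => - r x) dNJ _ dpsiP) => //.
  by rewrite -oppr0; exact: cvgN.
by move=> y yx0; apply: le_trans (rle y yx0); rewrite -normrN ler_norm.
Qed.

Lemma stein_sol_right_bound (psi dpsi : R -> R) x0 :
  (forall x : R, x0 <= x -> is_derive x 1 psi (dpsi x)) ->
  (forall x, x0 <= x -> 0 <= psi x) ->
  (forall x, x0 <= x -> a x / 2 * dpsi x + b x * psi x <= - `|r x|) ->
  forall x, x0 <= x -> `|g x| <= psi x.
Proof.
move=> dpsiP psi0 rle x xx0; apply: stein_sol_norm_le.
  apply: (right_comparison dJ Jy dpsiP) => // y yx0.
  by apply: le_trans (rle y yx0) _; rewrite lerNl -normrN ler_norm.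
apply: (right_comparison (r := fun x => - r x) dNJ _ dpsiP) => //.
  by rewrite -oppr0; exact: cvgN.
by move=> y yx0; apply: le_trans (rle y yx0) _; rewrite lerN2 ler_norm.
Qed.

Lemma stein_sol_segment_bound (s x0 x1 : R) : x0 <= x1 -> 
  (forall x, x0 <= x <= x1 -> b x * s <= - `|r x|) -> `|g x1| <= s ->
  `|g x0| <= s.
Proof.
move=> x01 rle g1.
have e1 := E_gt0 x1.
have : `|J x1| <= E x1 * s / 2.
  move: g1; rewrite /g normrM normfV (gtr0_norm e1) ler_pdivrMr// normrM ger0_norm//; lra.
rewrite ler_norml => /andP[h1 h2].
apply: (stein_sol_norm_le (psi := cst s)).
  apply: (right_comparison_segment dJ (dpsi := cst 0) x01) => /=.
  - move=> y /rle; rewrite mulr0 add0r => /le_trans; apply.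
    by rewrite lerNl -normrN ler_norm.
  - lra.
apply: (right_comparison_segment (r := fun x => - r x) dNJ (dpsi := cst 0) x01) => /=.
- move=> y /rle; rewrite mulr0 add0r => /le_trans; apply.
  by rewrite lerN2 ler_norm.
- lra.
Qed.

Section growth.
Variable M : R.
Hypothesis r_bound : forall x, `|r x| <= `|x| + 2 * M.
Hypotheses (M1 : 1 <= M) (be_or_M : be <= 1 \/ M = 1).

(** The supersolution 1 + 10 M / (3/2 - x) works up to x = 1: its first term
absorbs |x| for negative x through the drift, its second one dominates the
constant 2 M, since (a / 2) w^2 - x w >= c > 0 with w = 1 / (3/2 - x), where c is
1/5 for x <= 0 and 2/5 for 0 <= x <= 1. *)
Lemma stein_sol_bound_near x : x <= be -> x <= 1 -> `|g x| <= 21 * M.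
Proof.
move=> xbe x1; params; move: (M1) => ?.
apply: (@le_trans _ _ (1 + 10 * M * (3 / 2 - x)^-1)); last first.
  have : (3 / 2 - x)^-1 <= 2 by rewrite invf_ple ?posrE//; lra.
  move=> h; have : 10 * M * (3 / 2 - x)^-1 <= 10 * M * 2 by rewrite ler_wpM2l//; lra.
  lra.
apply: (stein_sol_left_bound (psi := fun x => 1 + 10 * M * (3 / 2 - x)^-1)
  (dpsi := fun x => 10 * M * (3 / 2 - x) ^- 2) (x0 := Num.min be 1)); last first.
- by rewrite le_min xbe.
- move=> y; rewrite le_min => /andP[ybe y1].
  rewrite stein_drift_left//; apply: le_trans (r_bound y) _.
  have d0 : 0 < 3 / 2 - y by lra.
  have [y0|y0] := ler0P y.
    have : 2 <= 5 * (3 / 2 - y) ^- 2 - 10 * y * (3 / 2 - y)^-1.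
      have -> : 5 * (3 / 2 - y) ^- 2 - 10 * y * (3 / 2 - y)^-1 =
         (5 - 10 * y * (3 / 2 - y)) / (3 / 2 - y) ^+ 2 by field; lra.
      rewrite ler_pdivlMr ?exprn_gt0//; nra.
    have p2 : 0 < (3 / 2 - y) ^- 2 by rewrite invr_gt0 exprn_gt0.
    move=> h; have : 5 * (3 / 2 - y) ^- 2 <= a y / 2 * (10 * (3 / 2 - y) ^- 2).
      by have := stein_diffusion_ge1 y; nra.
    set w1 := (3 / 2 - y)^-1 in h *; set w2 := (3 / 2 - y) ^- 2 in h p2 *.
    move=> h'; have : M * 2 <= M * (a y / 2 * (10 * w2) - 10 * y * w1) by rewrite ler_pM2l; lra.
    lra.
  have : 2 / 5 <= (3 / 2 - y) ^- 2 - y * (3 / 2 - y)^-1.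
    have -> : (3 / 2 - y) ^- 2 - y * (3 / 2 - y)^-1 =
       (1 - y * (3 / 2 - y)) / (3 / 2 - y) ^+ 2 by field; lra.
    rewrite ler_pdivlMr ?exprn_gt0//.
    have : 0 <= (y - 1 / 4) ^+ 2 by exact: sqr_ge0.
    nra.
  have p2 : 0 < (3 / 2 - y) ^- 2 by rewrite invr_gt0 exprn_gt0.
  move=> h; have : (3 / 2 - y) ^- 2 <= a y / 2 * (3 / 2 - y) ^- 2.
    have -> : a y = 2 + de * y.
      by rewrite stein_diffusion_mid// (@le_trans _ _ 0) ?oppr_le0 ?invr_ge0// ltW.
    have : 0 <= de * y * (3 / 2 - y) ^- 2 by rewrite !mulr_ge0// ltW.
    by lra.
  set w1 := (3 / 2 - y)^-1 in h *; set w2 := (3 / 2 - y) ^- 2 in h p2 *.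
  move=> h'; have : M * (2 / 5) <= M * (a y / 2 * w2 - y * w1) by rewrite ler_pM2l; lra.
  lra.
- move=> y; rewrite le_min => /andP[ybe y1].
  rewrite addr_ge0// mulr_ge0 ?invr_ge0//; lra.
- move=> y; rewrite le_min => /andP[ybe y1].
  by apply: is_derive_affine_inv; apply: lt0r_neq0; lra.
Qed.

(** Affine supersolution: on the right the drift is the constant - be, so the
slope 1/be matches the slope of |r|. *)
Lemma stein_sol_bound_right (s : R) : 0 <= s ->
  be + 2 * M + (2 + de * be) / (2 * be) <= be * s ->
  forall x, be <= x -> `|g x| <= s + (x - be) / be.
Proof.
move=> s0 sle; params.
apply: (stein_sol_right_bound (dpsi := fun=> be^-1)).
- move=> x _; apply: (@is_derive_eq _ _ _ (fun x => s + (x - be) * be^-1)).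
  by rewrite /GRing.scale /=; ring.
- by move=> x xbe; rewrite addr_ge0// divr_ge0// ?subr_ge0// ltW.
- move=> x xbe; rewrite stein_drift_right// stein_diffusion_right//.
  have := r_bound x; rewrite (ger0_norm (_ : 0 <= x)); last lra.
  have -> : - be * (s + (x - be) / be) = - (be * s) - x + be by field; rewrite gt_eqF.
  have -> : (2 + de * be) / 2 / be = (2 + de * be) / (2 * be) by field; rewrite gt_eqF.
  lra.
Qed.

(** When be > 1 there is a gap between 1 and be; there the drift is at most -1
and the constant 5 is a supersolution, started from the bound at be. *)
Lemma stein_sol_bound_left x : x <= be -> `|g x| <= 21 * M.
Proof.
move=> xbe; params; move: (M1) => ?.
have [x1|x1] := leP x 1; first exact: stein_sol_bound_near.
have M_eq1 : M = 1 by case: be_or_M => // be1; lra.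
have be1 : 1 < be by lra.
have g5 : `|g be| <= 5.
  have := @stein_sol_bound_right 5; rewrite M_eq1 => /(_ _ _ be (lexx be)).
  rewrite subrr mul0r addr0; apply=> //.
  have : (2 + de * be) / (2 * be) <= 3 / 2.
    rewrite ler_pdivrMr; last lra.
    have : de * be <= 1 * be by rewrite ler_pM2r.
    lra.
  lra.
suff : `|g x| <= 5 by lra.
apply: stein_sol_segment_bound xbe _ g5 => y /andP[xy ybe].
rewrite stein_drift_left//; have := r_bound y.
have y0 : 0 <= y by lra.
rewrite M_eq1 (ger0_norm y0); lra.
Qed.

Lemma stein_sol_linear_growth : exists2 K, 0 <= K & forall x, `|g x| <= K * (1 + `|x|).
Proof.
params; move: (M1) => ?.
pose s := be^-1 * (be + 2 * M + (2 + de * be) / (2 * be)).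
have q0 : 0 <= (2 + de * be) / (2 * be).
  by apply: divr_ge0; [rewrite addr_ge0// mulr_ge0// ltW|rewrite mulr_ge0// ltW].
have s0 : 0 <= s by rewrite mulr_ge0 ?invr_ge0 ?(ltW be0)//; lra.
have bi : 0 < be^-1 by rewrite invr_gt0.
exists (21 * M + s + be^-1); first lra.
move=> x; have [xbe|/ltW xbe] := leP x be.
  have K21 : 21 * M <= 21 * M + s + be^-1 by lra.
  apply: le_trans (stein_sol_bound_left xbe) _; apply: le_trans K21 _.
  by apply: ler_peMr; [lra|rewrite lerDl].
have := @stein_sol_bound_right s s0 _ x xbe; rewrite {1}/s mulVKf ?gt_eqF// => /(_ (lexx _)).
have -> : (x - be) / be = be^-1 * x - 1 by field; rewrite gt_eqF.
have x0 : 0 <= x by lra.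
rewrite (ger0_norm x0).
have : 0 <= M * x by rewrite mulr_ge0//; lra.
have : 0 <= s * x by rewrite mulr_ge0.
lra.
Qed.

End growth.

End solution.
End stein_solution.

(** * Second-order consistency of the chain with the Stein equation *)

(** The constant B, later taken to be 21 M, bounds g on the left and also absorbs the
constant in the bound on r. *)
Section stein_remainder.
Context {R : realType}.
Variables (de be B : R).
Hypotheses (de0 : 0 < de) (de1 : de <= 1) (be0 : 0 < be).
Hypotheses (B1 : 1 <= B) (Bbe : 1 <= B * be).
Variables (g g' r r' : R -> R).
Local Notation a := (stein_diffusion de be).
Local Notation b := (stein_drift be).
Hypotheses (dg : forall x : R, is_derive x 1 g (g' x))
  (g_eq : forall x, a x / 2 * g' x = r x - b x * g x)
  (dr : forall x : R, is_derive x 1 r (r' x))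
  (r_lip : forall x y, `|r x - r y| <= `|x - y|)
  (r'_lip : forall x y, `|r' x - r' y| <= `|x - y|)
  (r_bound : forall x, `|r x| <= `|x| + B)
  (g_left : forall x, x <= be -> `|g x| <= B).

Ltac params := move: (de0) (de1) (be0) (B1) => ? ? ? ?.

Let half_diffusion_le (u w x : R) : `|a x / 2 * u| <= w -> `|u| <= 2 * w.
Proof.
rewrite normrM ger0_norm; last by rewrite divr_ge0// ltW// stein_diffusion_gt0.
have := stein_diffusion_ge1 be de0 x => h.
have : 1 / 2 * `|u| <= a x / 2 * `|u| by rewrite ler_wpM2r//; lra.
lra.
Qed.

Let g_eq_left (x : R) : - de^-1 <= x -> x <= be -> a x / 2 * g' x = r x + x * g x.
Proof. by move=> x0 x1; rewrite g_eq stein_drift_left//; ring. Qed.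

Lemma stein_sol'_bound_left (x : R) : - de^-1 <= x -> x <= be ->
  `|g' x| <= 4 * B * (1 + `|x|).
Proof.
params; move=> x0 x1.
suff : `|a x / 2 * g' x| <= 2 * B * (1 + `|x|) by move/half_diffusion_le; lra.
rewrite g_eq_left//; apply: le_trans (ler_normD _ _) _; rewrite normrM.
have := r_bound x.
have : `|x| * `|g x| <= `|x| * B by rewrite ler_wpM2l ?g_left.
have : `|x| <= B * `|x| by rewrite ler_peMl.
lra.
Qed.

Lemma stein_sol_lip_left (x y : R) : - de^-1 <= x <= be -> - de^-1 <= y <= be ->
  `|y - x| <= 1 -> `|g y - g x| <= 8 * B * (1 + `|x|) * `|y - x|.
Proof.
move=> xI yI yx1; params.
have bd z : - de^-1 <= z -> z <= be -> `|z| <= 1 + `|x| ->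
    `|g' z| <= 8 * B * (1 + `|x|).
  move=> z0 z1 zx; apply: le_trans (stein_sol'_bound_left z0 z1) _.
  have -> : 8 * B * (1 + `|x|) = 4 * B * (2 * (1 + `|x|)) by ring.
  apply: ler_wpM2l; first lra.
  have := normr_ge0 x; lra.
wlog xy : x y xI yI yx1 bd / x <= y => [H|].
  have [/H|/ltW yx] := leP x y; first exact.
  have yx' : `|x - y| <= 1 by rewrite distrC.
  rewrite [X in X <= _]distrC [X in _ * X]distrC (ger0_norm (_ : 0 <= x - y)) ?subr_ge0//.
  apply: mean_value_ineq yx (fun z _ => dg z) _ => z /andP[yz zx].
  move: xI yI => /andP[? ?] /andP[? ?].
  apply: bd; [lra|lra|].
  have -> : z = x - (x - z) by ring.
  rewrite (le_trans (ler_normB _ _))// addrC lerD2r ger0_norm ?subr_ge0//.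
  move: yx'; rewrite ger0_norm ?subr_ge0//; lra.
rewrite (ger0_norm (_ : 0 <= y - x)) ?subr_ge0//.
apply: mean_value_ineq xy (fun z _ => dg z) _ => z /andP[xz zy].
move: xI yI => /andP[? ?] /andP[? ?].
apply: bd; [lra|lra|].
have -> : z = x + (z - x) by ring.
rewrite (le_trans (ler_normD _ _))// addrC lerD2r ger0_norm ?subr_ge0//.
move: yx1; rewrite ger0_norm ?subr_ge0//; lra.
Qed.

(** Subtract the equation at y from the equation at x: a and b are affine here,
so every term is a difference of a Lipschitz function. *)
Lemma stein_sol'_lip_left (x y : R) : - de^-1 <= x <= be -> - de^-1 <= y <= be ->
  `|y - x| <= 1 -> `|g' y - g' x| <= 24 * B * (1 + `|x|) ^+ 2 * `|y - x|.
Proof.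
move=> xI yI yx1; params.
suff : `|a y / 2 * (g' y - g' x)| <= 12 * B * (1 + `|x|) ^+ 2 * `|y - x|.
  by move/half_diffusion_le; lra.
have -> : a y / 2 * (g' y - g' x) =
    (r y - r x) + (y * (g y - g x) + ((y - x) * g x - (y - x) * (de / 2 * g' x))).
  have /andP[x0 x1] := xI; have /andP[y0 y1] := yI.
  have ey := g_eq_left y0 y1; have ex := g_eq_left x0 x1.
  have -> : a y / 2 * (g' y - g' x) =
     a y / 2 * g' y - a x / 2 * g' x - (a y - a x) / 2 * g' x by ring.
  by rewrite ey ex !stein_diffusion_mid//; ring.
have := stein_sol_lip_left xI yI yx1 => gl.
have /andP[x0 x1] := xI.
have X1 : 1 <= 1 + `|x| by rewrite lerDl.
have X0 := normr_ge0 x.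
have yX : `|y| <= 1 + `|x|.
  have -> : y = (y - x) + x by ring.
  by rewrite (le_trans (ler_normD _ _))// lerD2r.
have b1 : `|y * (g y - g x)| <= (1 + `|x|) * (8 * B * (1 + `|x|) * `|y - x|).
  by rewrite normrM; apply: ler_pM.
have b2 : `|(y - x) * g x| <= `|y - x| * B by rewrite normrM ler_wpM2l ?g_left.
have b3 : `|(y - x) * (de / 2 * g' x)| <= `|y - x| * (2 * B * (1 + `|x|)).
  rewrite normrM ler_wpM2l// normrM ger0_norm ?divr_ge0 ?(ltW de0)//.
  have -> : 2 * B * (1 + `|x|) = 1 / 2 * (4 * B * (1 + `|x|)) by field.
  apply: ler_pM => //; [by rewrite divr_ge0// ltW|lra|exact: stein_sol'_bound_left].
apply: le_trans (ler_normD _ _) _.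
apply: le_trans (lerD (r_lip y x) (ler_normD _ _)) _.
apply: le_trans (lerD (lexx _) (lerD b1 (le_trans (ler_normB _ _) (lerD b2 b3)))) _.
have d0 := normr_ge0 (y - x); move: (`|y - x|) (`|x|) d0 X0 => d X d0 X0.
have -> : d + ((1 + X) * (8 * B * (1 + X) * d) + (d * B + d * (2 * B * (1 + X)))) =
  (1 + B * (8 * (1 + X) ^+ 2 + 1 + 2 * (1 + X))) * d by ring.
rewrite ler_wpM2r//.
have : 1 <= B * (1 + X) ^+ 2 by rewrite -[1]mulr1 ler_pM// exprn_ege1//; lra.
have : B * (1 + 2 * (1 + X)) <= B * (3 * (1 + X) ^+ 2).
  rewrite ler_wpM2l//; first lra.
  have : 0 <= X ^+ 2 by exact: sqr_ge0.
  lra.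
lra.
Qed.

Let r_second_diff (x t : R) : 0 <= t -> `|r (x + t) + r (x - t) - 2 * r x| <= 2 * t ^+ 2.
Proof.
move=> t0.
have T u : `|u| <= t -> `|r (x + u) - r x - u * r' x| <= 1 * u ^+ 2.
  apply: (taylor1 dr) => // y _; rewrite mul1r; exact: r'_lip.
have -> : r (x + t) + r (x - t) - 2 * r x =
  (r (x + t) - r x - t * r' x) + (r (x + - t) - r x - (- t) * r' x) by ring.
apply: le_trans (ler_normD _ _) _.
have := T t; have := T (- t); rewrite normrN (ger0_norm t0) lexx sqrrN => /(_ isT) ? /(_ isT) ?.
lra.
Qed.

Let g_second_diff (L x t : R) : 0 <= t -> 0 <= L ->
  (forall y, `|y - x| <= t -> `|g' y - g' x| <= L * `|y - x|) ->
  `|g (x + t) + g (x - t) - 2 * g x| <= 2 * L * t ^+ 2.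
Proof.
move=> t0 L0 Lg.
have T := taylor1 dg Lg L0.
have -> : g (x + t) + g (x - t) - 2 * g x =
  (g (x + t) - g x - t * g' x) + (g (x + - t) - g x - (- t) * g' x) by ring.
apply: le_trans (ler_normD _ _) _.
have := T t; have := T (- t); rewrite normrN (ger0_norm t0) lexx sqrrN => /(_ isT) ? /(_ isT) ?.
lra.
Qed.

(** Take the second difference of the equation.  The affine coefficients
produce, besides second differences of r and g, only first differences
multiplied by t. *)
Lemma stein_sol'_second_diff_left (x t : R) : - de^-1 <= x - t -> x + t <= be ->
  0 <= t <= 1 ->
  `|g' (x + t) + g' (x - t) - 2 * g' x| <= 180 * B * (1 + `|x|) ^+ 3 * t ^+ 2.
Proof.
move=> xl xr /andP[t0 t1]; params.
suff : `|a x / 2 * (g' (x + t) + g' (x - t) - 2 * g' x)| <=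
   90 * B * (1 + `|x|) ^+ 3 * t ^+ 2 by move/half_diffusion_le; lra.
have xI : - de^-1 <= x <= be by apply/andP; split; lra.
have lipI y : `|y - x| <= t -> `|g' y - g' x| <= 24 * B * (1 + `|x|) ^+ 2 * `|y - x|.
  move=> yx; apply: stein_sol'_lip_left => //; last exact: le_trans t1.
  by move: yx; rewrite ler_norml => /andP[? ?]; apply/andP; split; lra.
have X0 := normr_ge0 x.
have L0 : 0 <= 24 * B * (1 + `|x|) ^+ 2.
  by rewrite mulr_ge0 ?sqr_ge0//; lra.
have pI : - de^-1 <= x + t <= be by apply/andP; split; lra.
have mI : - de^-1 <= x - t <= be by apply/andP; split; lra.
have tn : `|x + t - x| = t by rewrite addrAC subrr add0r ger0_norm.
have tn' : `|x - t - x| = t by rewrite addrAC subrr add0r normrN ger0_norm.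
have gp := stein_sol_lip_left xI pI; rewrite tn in gp; have {}gp := gp t1.
have gm := stein_sol_lip_left xI mI; rewrite tn' in gm; have {}gm := gm t1.
have dp := lipI (x + t); rewrite tn lexx in dp; have {}dp := dp isT.
have dm := lipI (x - t); rewrite tn' lexx in dm; have {}dm := dm isT.
have s2 := g_second_diff t0 L0 lipI.
have s1 := r_second_diff x t0.
have -> : a x / 2 * (g' (x + t) + g' (x - t) - 2 * g' x) =
    (r (x + t) + r (x - t) - 2 * r x) + (x * (g (x + t) + g (x - t) - 2 * g x)
    + (t * ((g (x + t) - g x) - (g (x - t) - g x))
       - de * t / 2 * ((g' (x + t) - g' x) - (g' (x - t) - g' x)))).
  move: xI pI mI => /andP[x0 x1] /andP[p0 p1] /andP[m0 m1].
  have ep := g_eq_left p0 p1; have em := g_eq_left m0 m1; have ex := g_eq_left x0 x1.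
  rewrite !stein_diffusion_mid// in ep em ex *.
  have -> : (2 + de * x) / 2 * (g' (x + t) + g' (x - t) - 2 * g' x) =
     (2 + de * (x + t)) / 2 * g' (x + t) + (2 + de * (x - t)) / 2 * g' (x - t)
     - 2 * ((2 + de * x) / 2 * g' x) - de * t / 2 * (g' (x + t) - g' (x - t)) by field.
  by rewrite ep em ex; field.
have c2 : `|x * (g (x + t) + g (x - t) - 2 * g x)| <=
    (1 + `|x|) * (2 * (24 * B * (1 + `|x|) ^+ 2) * t ^+ 2).
  by rewrite normrM; apply: ler_pM => //; lra.
have c3 : `|t * ((g (x + t) - g x) - (g (x - t) - g x))| <=
    t * (2 * (8 * B * (1 + `|x|) * t)).
  rewrite normrM (ger0_norm t0) ler_wpM2l//.
  apply: le_trans (ler_normB _ _) _; lra.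
have c4 : `|de * t / 2 * ((g' (x + t) - g' x) - (g' (x - t) - g' x))| <=
    t / 2 * (2 * (24 * B * (1 + `|x|) ^+ 2 * t)).
  rewrite normrM; apply: ler_pM => //.
    rewrite ger0_norm ?divr_ge0 ?mulr_ge0 ?(ltW de0)//.
    have : de * t <= 1 * t by rewrite ler_wpM2r.
    lra.
  apply: le_trans (ler_normB _ _) _; lra.
apply: le_trans (ler_normD _ _) _.
apply: le_trans (lerD s1 (ler_normD _ _)) _.
apply: le_trans (lerD (lexx _) (lerD c2 (le_trans (ler_normB _ _) (lerD c3 c4)))) _.
move: (`|x|) X0 => X X0.
have -> : 2 * t ^+ 2 +
 ((1 + X) * (2 * (24 * B * (1 + X) ^+ 2) * t ^+ 2) +
  (t * (2 * (8 * B * (1 + X) * t)) +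
   t / 2 * (2 * (24 * B * (1 + X) ^+ 2 * t)))) =
  (2 + B * (48 * (1 + X) ^+ 3 + 16 * (1 + X) + 24 * (1 + X) ^+ 2)) * t ^+ 2 by field.
rewrite ler_wpM2r ?sqr_ge0//.
have : 1 <= B * (1 + X) ^+ 3 by rewrite -[1]mulr1 ler_pM// exprn_ege1//; lra.
have : B * (16 * (1 + X) + 24 * (1 + X) ^+ 2) <= B * (40 * (1 + X) ^+ 3).
  rewrite ler_wpM2l//; first lra.
  have : 0 <= X ^+ 2 by exact: sqr_ge0.
  have : 0 <= X ^+ 3 by exact: exprn_ge0.
  lra.
lra.
Qed.


Variable K : R.
Hypotheses (K0 : 0 <= K) (g_growth : forall x, `|g x| <= K * (1 + `|x|)).

Let A := 2 + de * be.
Let A2 : 2 <= A.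
Proof. by rewrite lerDl mulr_ge0// ltW. Qed.

Let g_eq_right (x : R) : be <= x -> g' x = 2 / A * (r x + be * g x).
Proof.
move=> xbe; have := g_eq x.
rewrite stein_diffusion_right// stein_drift_right// mulNr opprK -/A => <-.
by field; apply: lt0r_neq0; move: A2; lra.
Qed.

(** On the right z(y) = g'(y + s) - g'(y) satisfies
A z' / 2 - be z = r'(y + s) - r'(y), whose right-hand side is at most s; as g'
grows linearly, z cannot exceed s / be. *)
Lemma stein_sol'_lip_right (x s : R) : 0 <= s -> be <= x ->
  `|g' (x + s) - g' x| <= s / be.
Proof.
params; move=> s0 xbe; move: (A2) (K0) => ? ?.
have A0 : A != 0 by apply: lt0r_neq0; lra.
have iA0 : 0 <= 2 / A by apply: divr_ge0 => //; lra.
have iA1 : 2 / A <= 1 by rewrite ler_pdivrMr; lra.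
pose z y := 2 / A * ((r (y + s) + be * g (y + s)) - (r y + be * g y)).
pose dz y := 2 / A * ((r' (y + s) + be * g' (y + s)) - (r' y + be * g' y)).
have zE y : be <= y -> z y = g' (y + s) - g' y.
  by move=> ybe; rewrite !g_eq_right//; [rewrite /z mulrBr|lra].
have dzP (y : R) : is_derive y 1 z (dz y).
  have trans (f f' : R -> R) : (forall y : R, is_derive y 1 f (f' y)) ->
      is_derive y 1 (fun y => f (y + s)) (f' (y + s)).
    move=> df; rewrite (_ : (fun y => f (y + s)) = (fun y => f (s + y))); last first.
      by apply/funext => u; rewrite addrC.
    by apply: is_derive_translate; rewrite addrC; exact: df.
  have h1 := trans _ _ dr; have h2 := trans _ _ dg.
  have H := is_deriveZ (2 / A) (is_deriveB
    (is_deriveD h1 (is_deriveZ be h2)) (is_deriveD (dr y) (is_deriveZ be (dg y)))).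
  exact: H.
have side (sg : R) : `|sg| = 1 -> sg * z x <= s / be.
  move=> sg1.
  apply: (@linear_growth_comparison _ (fun y => sg * z y) (fun y => sg * dz y)
    (2 * be / A) (s / be) (s + be * K * (2 + s)) x).
  - by apply: divr_gt0; lra.
  - move=> y xy; have ybe : be <= y by lra.
    have -> : sg * dz y = 2 / A * (sg * (r' (y + s) - r' y)) + 2 * be / A * (sg * z y).
      by rewrite /dz zE//; field.
    have -> : 2 * be / A * (sg * z y - s / be) = 2 * be / A * (sg * z y) - 2 / A * s.
      by field; rewrite A0 gt_eqF.
    have : - s <= sg * (r' (y + s) - r' y).
      rewrite lerNl -mulNr; apply: le_trans (ler_norm _) _.
      rewrite normrM normrN sg1 mul1r; apply: le_trans (r'_lip _ _) _.
      by rewrite addrAC subrr add0r ger0_norm.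
    by move=> /(ler_wpM2l iA0); lra.
  - move=> y xy; rewrite normrM sg1 mul1r /z normrM (ger0_norm iA0).
    apply: le_trans (_ : 1 * `|r (y + s) + be * g (y + s) - (r y + be * g y)| <= _).
      exact: ler_wpM2r.
    rewrite mul1r.
    have -> : r (y + s) + be * g (y + s) - (r y + be * g y) =
      (r (y + s) - r y) + be * (g (y + s) - g y) by ring.
    apply: le_trans (ler_normD _ _) _; rewrite normrM (gtr0_norm be0).
    have h1 : `|r (y + s) - r y| <= s.
      by apply: le_trans (r_lip _ _) _; rewrite addrAC subrr add0r ger0_norm.
    have y0 := normr_ge0 y.
    have h2 : `|g (y + s) - g y| <= K * ((2 + s) * (1 + `|y|)).
      apply: le_trans (ler_normB _ _) _.
      apply: le_trans (lerD (g_growth _) (g_growth _)) _.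
      rewrite -mulrDr ler_wpM2l//.
      have : `|y + s| <= `|y| + s by rewrite (le_trans (ler_normD _ _))// (ger0_norm s0).
      have : 0 <= s * `|y| by rewrite mulr_ge0.
      lra.
    have h3 : be * `|g (y + s) - g y| <= be * (K * ((2 + s) * (1 + `|y|))).
      by rewrite ler_wpM2l// ltW.
    have : 0 <= s * `|y| by rewrite mulr_ge0.
    lra.
rewrite -zE// ler_norml; apply/andP; split.
- by rewrite lerNl -mulN1r side// normrN1.
- by rewrite -[z x]mul1r side// normr1.
Qed.

(** The second order error of the trapezoidal test function. *)
Definition stein_rem e x :=
  ((g (x + de) - g x - de * g' x) - e * (g (x - de) - g x + de * g' x)) / (2 * de).

Lemma stein_rem_eq (e x : R) : a x = 1 + e -> de * b x = 1 - e ->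
  (g x + g (x + de)) / (2 * de) - e * ((g (x - de) + g (x - de + de)) / (2 * de))
  = r x + stein_rem e x.
Proof.
move=> ae be_.
have de_neq0 : de != 0 by rewrite gt_eqF.
have -> : r x = (1 + e) / 2 * g' x + (1 - e) / de * g x.
  have := g_eq x; rewrite ae => ->.
  by rewrite -be_ (mulrC de) mulfK//; ring.
by rewrite /stein_rem subrK; field.
Qed.

Let rem_le e x u : `|(g (x + de) - g x - de * g' x) - e * (g (x - de) - g x + de * g' x)|
  <= 2 * de * u -> `|stein_rem e x| <= u.
Proof.
move=> h; rewrite /stein_rem normrM normfV (gtr0_norm (_ : 0 < 2 * de)); last first.
  by rewrite mulr_gt0.
by rewrite ler_pdivrMr ?mulr_gt0// (mulrC u).
Qed.

Let sqr_le_de (t : R) : 0 <= t -> t <= de -> t ^+ 2 <= de ^+ 2.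
Proof. by move=> t0 td; rewrite !expr2; apply: ler_pM. Qed.

(** Write the numerator as w - de be v, where w is the centered remainder, of
order de^3, and v the backward one: its bound de^2 / be is compensated by the
factor be. *)
Lemma stein_rem_right (x : R) : be <= x - de ->
  `|stein_rem (1 + de * be) x| <= 5 / 2 * de ^+ 2.
Proof.
move=> xbe; params; have ib : 0 < be^-1 by rewrite invr_gt0.
have lipI y : `|y - x| <= de -> `|g' y - g' x| <= be^-1 * `|y - x|.
  rewrite ler_norml => /andP[y0 y1].
  have [xy|/ltW yx] := leP x y.
    rewrite (ger0_norm (_ : 0 <= y - x)) ?subr_ge0// mulrC.
    rewrite [in X in `|X|](_ : y = x + (y - x)); last ring.
    by apply: stein_sol'_lip_right; lra.
  rewrite distrC [X in _ * X]distrC (ger0_norm (_ : 0 <= x - y)) ?subr_ge0// mulrC.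
  rewrite [in X in `|X|](_ : x = y + (x - y)); last ring.
  by apply: stein_sol'_lip_right; lra.
have T := taylor1 dg lipI (ltW ib) (t := - de).
rewrite normrN gtr0_norm// lexx sqrrN mulNr opprK in T; have {}T := T isT.
have W : `|g (x + de) - g (x - de) - 2 * de * g' x| <= 4 * de ^+ 2 * de.
  apply: (taylor2_centered (ltW de0) dg) => t /andP[t0 t1].
  apply: (@le_trans _ _ (4 * t ^+ 2)); last first.
    by rewrite ler_wpM2l// sqr_le_de.
  have s1 := r_second_diff x t0.
  have s2 := g_second_diff t0 (ltW ib) (fun y yx => lipI y (le_trans yx t1)).
  rewrite !g_eq_right; [|lra|lra|lra].
  have -> : 2 / A * (r (x + t) + be * g (x + t)) +
     2 / A * (r (x - t) + be * g (x - t)) - 2 * (2 / A * (r x + be * g x)) =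
     2 / A * ((r (x + t) + r (x - t) - 2 * r x) + be * (g (x + t) + g (x - t) - 2 * g x)).
    by ring.
  have a2 := A2.
  rewrite normrM ger0_norm; last by apply: divr_ge0 => //; lra.
  rewrite -[X in _ <= X]mul1r; apply: ler_pM => //.
  - by apply: divr_ge0 => //; lra.
  - by rewrite ler_pdivrMr; lra.
  apply: le_trans (ler_normD _ _) _; rewrite normrM (gtr0_norm be0).
  have : be * `|g (x + t) + g (x - t) - 2 * g x| <= be * (2 * be^-1 * t ^+ 2).
    by rewrite ler_wpM2l// ltW.
  rewrite (_ : be * (2 * be^-1 * t ^+ 2) = 2 * t ^+ 2); last by field; rewrite gt_eqF.
  lra.
apply: rem_le.
rewrite (_ : g (x + de) - g x - de * g' x - (1 + de * be) * (g (x - de) - g x + de * g' x)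
  = (g (x + de) - g (x - de) - 2 * de * g' x) - de * be * (g (x - de) - g x + de * g' x)); last ring.
apply: le_trans (ler_normB _ _) _; rewrite normrM (gtr0_norm (_ : 0 < de * be)) ?mulr_gt0//.
have : de * be * `|g (x - de) - g x + de * g' x| <= de * be * (be^-1 * de ^+ 2).
  by rewrite ler_wpM2l// ltW// mulr_gt0.
rewrite (_ : de * be * (be^-1 * de ^+ 2) = de ^+ 3); last by field; rewrite gt_eqF.
lra.
Qed.

Let lip_left_near (x y : R) : - de^-1 <= x <= be -> - de^-1 <= y <= be -> `|y - x| <= de ->
   `|g' y - g' x| <= 24 * B * (1 + `|x|) ^+ 2 * `|y - x|.
Proof. by move=> xI yI yx; apply: stein_sol'_lip_left => //; apply: le_trans de1. Qed.

Let L_ge0 (x : R) : 0 <= 24 * B * (1 + `|x|) ^+ 2.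
Proof. by params; rewrite mulr_ge0 ?sqr_ge0//; lra. Qed.

Let taylor_left_back (x : R) : - de^-1 <= x - de -> x <= be ->
  `|g (x - de) - g x + de * g' x| <= 24 * B * (1 + `|x|) ^+ 2 * de ^+ 2.
Proof.
move=> x0 x1; params.
have := taylor1_directed (x := x) (t := - de) dg _ (L_ge0 x).
rewrite mulNr opprK sqrrN normrN (gtr0_norm de0); apply => u /andP[u0 u1].
have ud : 0 <= u * de <= de by rewrite mulr_ge0 ?(ltW de0)//= ler_piMl// ltW.
have := @lip_left_near x (x + u * - de).
rewrite mulrN [x - _ - x]addrAC subrr add0r normrN ger0_norm; last by case/andP: ud.
by move/andP: ud => [? ?]; apply; [apply/andP; split; lra|apply/andP; split; lra|].
Qed.

Let taylor_left_forth (x : R) : - de^-1 <= x -> x + de <= be ->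
  `|g (x + de) - g x - de * g' x| <= 24 * B * (1 + `|x|) ^+ 2 * de ^+ 2.
Proof.
move=> x0 x1; params.
apply: taylor1_directed => // u /andP[u0 u1]; rewrite (gtr0_norm de0).
have ud : 0 <= u * de <= de by rewrite mulr_ge0 ?(ltW de0)//= ler_piMl// ltW.
have := @lip_left_near x (x + u * de).
rewrite [x + _ - x]addrAC subrr add0r ger0_norm; last by case/andP: ud.
by move/andP: ud => [? ?]; apply; [apply/andP; split; lra|apply/andP; split; lra|].
Qed.

Lemma stein_rem_left (x : R) : - de^-1 <= x - de -> x + de <= be ->
  `|stein_rem (1 + de * x) x| <= 102 * B * (1 + `|x|) ^+ 3 * de ^+ 2.
Proof.
move=> xl xr; params.
have T := taylor_left_back xl; have {}T := T (ltac:(lra)).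
have W : `|g (x + de) - g (x - de) - 2 * de * g' x| <= 180 * B * (1 + `|x|) ^+ 3 * de ^+ 2 * de.
  apply: (taylor2_centered (ltW de0) dg) => t /andP[t0 t1].
  apply: (@le_trans _ _ (180 * B * (1 + `|x|) ^+ 3 * t ^+ 2)); last first.
    rewrite ler_wpM2l//; last by rewrite sqr_le_de.
    by rewrite mulr_ge0 ?exprn_ge0 ?addr_ge0//; lra.
  by apply: stein_sol'_second_diff_left; [lra|lra|rewrite t0/=; lra].
apply: rem_le.
rewrite (_ : g (x + de) - g x - de * g' x - (1 + de * x) * (g (x - de) - g x + de * g' x)
  = (g (x + de) - g (x - de) - 2 * de * g' x) - x * (de * (g (x - de) - g x + de * g' x))); last ring.
apply: le_trans (ler_normB _ _) _; rewrite normrM normrM (gtr0_norm de0).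
have X0 := normr_ge0 x.
have : `|x| * (de * `|g (x - de) - g x + de * g' x|) <=
    (1 + `|x|) * (de * (24 * B * (1 + `|x|) ^+ 2 * de ^+ 2)).
  apply: ler_pM => //; first by rewrite mulr_ge0// ltW.
    by rewrite lerDr.
  by rewrite ler_pM2l.
lra.
Qed.

(** At the left end of the grid there is no death, hence no cancellation
between the two sides; but 1 <= de (1 + |x|) at x = - 1/de, which supplies the
missing factor de. *)
Lemma stein_rem_zero : - de^-1 + de <= be ->
  `|stein_rem 0 (- de^-1)| <= 12 * B * (1 + `|- de^-1|) ^+ 3 * de ^+ 2.
Proof.
move=> h; params; have T := taylor_left_forth (lexx (- de^-1)) h.
apply: rem_le; rewrite mul0r subr0; apply: le_trans T _.
have i0 : 0 < de^-1 by rewrite invr_gt0.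
rewrite normrN (gtr0_norm i0).
have -> : 2 * de * (12 * B * (1 + de^-1) ^+ 3 * de ^+ 2) =
   24 * B * (1 + de^-1) ^+ 2 * de ^+ 2 * (1 + de) by field; rewrite gt_eqF.
rewrite ler_peMr//; last lra.
by rewrite !mulr_ge0 ?sqr_ge0//; lra.
Qed.

(** Here the two sides of the point obey different equations and the first
order remainders do not cancel, so one power of de is lost. *)
Lemma stein_rem_kink : - de^-1 <= be - de ->
  `|stein_rem (1 + de * be) be| <= 13 * B * (1 + be) ^+ 3 * de.
Proof.
move=> h; params; have T := taylor_left_back h (lexx be).
have ib : 0 < be^-1 by rewrite invr_gt0.
have T' : `|g (be + de) - g be - de * g' be| <= B * de ^+ 2.
  apply: (@le_trans _ _ (be^-1 * de ^+ 2)).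
    apply: taylor1_directed (ltW ib) => // u /andP[u0 u1].
    rewrite (gtr0_norm de0) (mulrC be^-1); apply: stein_sol'_lip_right => //.
    by rewrite mulr_ge0// ltW.
  by rewrite ler_wpM2r ?sqr_ge0// -div1r ler_pdivrMr.
rewrite (gtr0_norm be0) in T.
apply: rem_le; apply: le_trans (ler_normB _ _) _.
rewrite normrM (gtr0_norm (_ : 0 < 1 + de * be)); last by rewrite addr_gt0// mulr_gt0.
have c : 1 + de * be <= 1 + be by rewrite lerD2l ler_piMl// ltW.
have : (1 + de * be) * `|g (be - de) - g be + de * g' be| <=
    (1 + be) * (24 * B * (1 + be) ^+ 2 * de ^+ 2).
  by apply: ler_pM => //; rewrite addr_ge0// mulr_ge0// ltW.
have : B * de ^+ 2 <= B * (1 + be) ^+ 3 * de ^+ 2.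
  rewrite ler_wpM2r ?sqr_ge0// ler_peMr//; first lra.
  by rewrite exprn_ege1//; lra.
have : 0 <= B * de ^+ 2 by rewrite mulr_ge0 ?sqr_ge0//; lra.
lra.
Qed.

End stein_remainder.

(** * Laws with a continuous density *)

Lemma continuous_integrable_itv {R : realType} (f : R -> R) (u v : R) :
  continuous f -> (@lebesgue_measure R).-integrable `[u, v] (EFin \o f).
Proof.
move=> cf; apply: continuous_compact_integrable; first exact: segment_compact.
exact: continuous_subspaceT.
Qed.

Lemma is_derive_oriented_integral0 {R : realType} (c : R -> R) :
  continuous c -> forall x : R, is_derive x 1 (oriented_integral0 c) (c x).
Proof.
move=> cc x; set mu := @lebesgue_measure R.
pose lo : R := - (`|x| + 1); pose F (y : R) : R := \int[mu]_(t in `[lo, y]) c t.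
have x0 := normr_ge0 x; have nx := ler_norm x; have nx' := ler_norm (- x).
rewrite normrN in nx'.
have lox : lo < x by rewrite /lo; lra.
have lo0 : lo < 0 by rewrite /lo; lra.
have chasles (u v : R) : lo <= u -> u <= v ->
    F v - F u = \int[mu]_(t in `[u, v]) c t.
  move=> lou uv; rewrite /F Rintegral_itvB ?bnd_simp//.
    by rewrite Rintegral_itv_obnd_cbnd//; apply: integrableS (continuous_integrable_itv u v cc) => //;
      exact: subset_itv_oc_cc.
  exact: continuous_integrable_itv.
have [dF F'x] : derivable F x 1 /\ (F^`())%classic x = c x.
  apply: (@continuous_FTC1_closed _ c lo x (x + 1)) => //; first by rewrite ltrDl.
    exact: continuous_integrable_itv.
  exact: cc.
have dFx : is_derive x 1 F (c x) by rewrite -F'x derive1E; exact: derivableP.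
have dG : is_derive x 1 (F - cst (F 0)) (c x).
  by apply: is_derive_eq; rewrite subr0.
apply: near_eq_is_derive dG; exists 1 => //= y /=; rewrite ltr_norml => /andP[xy1 xy2].
have loy : lo <= y by rewrite /lo; lra.
rewrite /oriented_integral0; case: ifPn => [y0|].
  by rewrite -chasles// ltW.
by rewrite -ltNge => /ltW y0; rewrite -chasles// opprB.
Qed.

(** The density agrees almost everywhere with the Radon-Nikodym derivative, which
gives the change of variables for integrals. *)
Section density.
Context {R : realType}.
Local Notation mu := (@lebesgue_measure R).
Variables (nu : probability (measurableTypeR R) R) (f : R -> R).
Hypothesis cf : continuous f.
Hypothesis nuE : forall A, measurable A ->
  nu A = (\int[mu]_(x in A) (f x)%:E)%E.

Let mf : measurable_fun setT f.
Proof. exact: continuous_measurable_fun. Qed.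

Lemma density_dominates : nu `<< mu.
Proof.
apply/null_content_dominatesP => A mA muA0; rewrite nuE//.
apply: null_set_integral => //; first exact/measurable_EFinP/measurable_funTS.
Qed.

Lemma density_ae_eq : ae_eq mu setT (EFin \o f) (Radon_Nikodym_SigmaFinite.f nu mu).
Proof.
apply: ae_eq_sym; apply: integral_ae_eq => //.
- exact: Radon_Nikodym_SigmaFinite.f_integrable density_dominates.
- exact/measurable_EFinP.
- by move=> A _ mA; apply: etrans (nuE mA); apply/esym/(Radon_Nikodym_SigmaFinite.f_integral density_dominates).
Qed.

Lemma ge0_integral_density (U : set R) (phi : R -> \bar R) :
  measurable U -> measurable_fun U phi -> (forall x, 0 <= phi x)%E ->
  (\int[nu]_(x in U) phi x = \int[mu]_(x in U) (phi x * (f x)%:E))%E.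
Proof.
move=> mU mphi phi0.
rewrite -(Radon_Nikodym_SigmaFinite.change_of_variables density_dominates)//.
apply: ae_eq_integral => //.
- apply: emeasurable_funM => //; apply: measurable_funTS.
  exact: (measurable_int mu (Radon_Nikodym_SigmaFinite.f_integrable density_dominates)).
- by apply: emeasurable_funM => //; apply: measurable_funTS; exact/measurable_EFinP.
- apply: ae_eqe_mul2l.
  apply: ae_eq_sym; apply: ae_eq_subset density_ae_eq => //.
Qed.

Lemma integral_density (U : set R) (phi : R -> \bar R) :
  measurable U -> nu.-integrable U phi ->
  (\int[nu]_(x in U) phi x = \int[mu]_(x in U) (phi x * (f x)%:E))%E.
Proof.
move=> mU iphi; have mphi : measurable_fun U phi := measurable_int _ iphi.
rewrite -(Radon_Nikodym_change_of_variables density_dominates)//.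
apply: ae_eq_integral => //.
- apply: emeasurable_funM => //; apply: measurable_funTS.
  by apply: (measurable_int mu); apply: Radon_Nikodym_integrable; exact: density_dominates.
- by apply: emeasurable_funM => //; apply: measurable_funTS; exact/measurable_EFinP.
- apply: ae_eqe_mul2l; apply: ae_eq_sym; apply: ae_eq_trans.
    by apply: ae_eq_subset density_ae_eq.
  exact: (ae_eq_Radon_Nikodym_SigmaFinite density_dominates mU).
Qed.

End density.

Section tails.
Context {R : realType}.
Local Notation mu := (@lebesgue_measure R).

(** Dominated convergence for the indicators of half-lines. *)
Lemma cvg_tail_integral (q : R -> R) : mu.-integrable setT (EFin \o q) ->
  \int[mu]_(t in `]-oo, - j%:R]) q t @[j --> \oo] --> (0 : R) /\
  \int[mu]_(t in `]-oo, j%:R]) q t @[j --> \oo] --> \int[mu]_t q t.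
Proof.
move=> iq; have mq : measurable_fun setT (EFin \o q) := measurable_int _ iq.
have conv (s : nat -> R) (l : R -> R) : measurable_fun setT (EFin \o l) ->
    (forall x, \forall j \near \oo, ((EFin \o q) \_ `]-oo, s j]) x = (l x)%:E) ->
    \int[mu]_(t in `]-oo, s j]) q t @[j --> \oo] --> \int[mu]_t l t.
  move=> ml near_l.
  pose F j := (EFin \o q) \_ `]-oo, s j].
  have [||||il _ cv] := @dominated_convergence _ _ _ mu setT measurableT F (EFin \o l)
    (abse \o (EFin \o q)) _ ml.
  - by move=> j; apply/(measurable_restrict _ _ _) => //; rewrite setTI; exact: measurable_funTS.
  - apply: aeW => x _; have h := near_l x.
    by apply: cvg_near_cst; exact: h.
  - exact: integrable_abse.
  - apply: aeW => x j _; rewrite /F patchE; case: ifPn => // _.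
    by rewrite (_ : point = 0%E)// abse0; exact: abse_ge0.
  have -> : (fun j => \int[mu]_(t in `]-oo, s j]) q t) =
      (fun j => fine (\int[mu]_t F j t)%E).
    by apply/funext => j; rewrite /Rintegral integral_mkcond.
  have fi : (\int[mu]_t (EFin \o l) t)%E \is a fin_num by exact: integrable_fin_num.
  by rewrite /Rintegral; apply: fine_cvg; rewrite fineK.
split.
  rewrite -[X in _ --> X](_ : \int[mu]_t (cst 0) t = 0); last first.
    by rewrite /Rintegral integral0.
  apply: (conv (fun j => - j%:R)) => [|x].
    exact/measurable_EFinP/measurable_cst.
  exists (Num.truncn (- x)).+1 => // j /= xj; rewrite patchE memNset//= in_itv/=.
  apply/negP; rewrite -ltNge ltrNl.
  by apply: lt_le_trans (truncnS_gt _) _; rewrite ler_nat.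
apply: (conv (fun j => j%:R)) => // x.
exists (Num.truncn x).+1 => // j /= xj; rewrite patchE mem_set//= in_itv/=.
by apply: ltW; apply: lt_le_trans (truncnS_gt _) _; rewrite ler_nat.
Qed.

End tails.

(** * The stationary law of the diffusion *)

Lemma is_derive_continuous {R : realType} (F F' : R -> R) :
  (forall x : R, is_derive x 1 F (F' x)) -> continuous F.
Proof.
by move=> dF x; apply: differentiable_continuous; apply/derivable1_diffP; have [] := dF x.
Qed.

Lemma Rintegral_derive {R : realType} (F F' : R -> R) (u v : R) : u < v ->
  (forall x : R, is_derive x 1 F (F' x)) -> continuous F' ->
  \int[@lebesgue_measure R]_(x in `[u, v]) F' x = F v - F u.
Proof.
move=> uv dF cF'; have cF := is_derive_continuous dF.
rewrite /Rintegral (@continuous_FTC2 _ F' F u v uv)//.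
- exact: continuous_subspaceT.
- split.
  + by move=> x _; have [] := dF x.
  + by apply: cvg_at_right_filter; exact: cF.
  + by apply: cvg_at_left_filter; exact: cF.
- by move=> x _; rewrite derive1E derive_val.
Qed.

Section stationary_diffusion.
Context {R : realType}.
Local Notation mu := (@lebesgue_measure R).
Variables (de be M kap : R) (E : R -> R).
Local Notation a := (stein_diffusion de be).
Local Notation b := (stein_drift be).
Hypotheses (de0 : 0 < de) (de1 : de <= 1) (be0 : 0 < be) (kap0 : 0 < kap).
Hypotheses (M1 : 1 <= M) (Mbe : 1 <= M * be) (be_or_M : be <= 1 \/ M = 1).
Hypotheses (E_gt0 : forall x, 0 < E x)
  (dE : forall x : R, is_derive x 1 E (2 * b x / a x * E x)).
Variable nu : probability (measurableTypeR R) R.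
Let f x := kap * E x / a x.
Hypothesis nuE : forall A, measurable A -> nu A = (\int[mu]_(x in A) (f x)%:E)%E.

Ltac params := move: (de0) (de1) (be0) (M1) => ? ? ? ?.

Lemma continuous_stein_drift : continuous b.
Proof.
by move=> x; apply: cvgN; apply: (@continuous_min _ _ id (cst be)); [exact: cvg_id|exact: cvg_cst].
Qed.

Lemma continuous_stein_diffusion : continuous a.
Proof.
move=> x; apply: cvgD; first exact: cvg_cst.
apply: cvgM; first exact: cvg_cst.
apply: (@continuous_max _ _ (cst (- de^-1)) (fun x => Num.min x be)); first exact: cvg_cst.
by apply: (@continuous_min _ _ id (cst be)); [exact: cvg_id|exact: cvg_cst].
Qed.

Let cE : continuous E := is_derive_continuous dE.

Let f_ge0 x : 0 <= f x.
Proof.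
by apply: divr_ge0; [rewrite mulr_ge0// ltW|rewrite ltW// stein_diffusion_gt0].
Qed.

Let cf : continuous f.
Proof.
move=> x; apply: cvgM; first by apply: cvgM; [exact: cvg_cst|exact: cE].
apply: cvgV; first by rewrite gt_eqF// stein_diffusion_gt0.
exact: continuous_stein_diffusion.
Qed.

(** The generator applied to x^2/2 is at most 2 - |x|/M.  For be <= 1 the worst
region is the right one, where the restoring drift is only be >= 1/M. *)
Let lyapunov x : a x / 2 + b x * x <= 2 - `|x| / M.
Proof.
params; have M0 : 0 < M by lra.
have xM : `|x| / M <= `|x| by rewrite ler_pdivrMr// ler_peMr.
have [x0|x0] := leP x 0.
  have := stein_diffusion_neg be de0 x0; rewrite stein_drift_left; last lra.
  move: xM; rewrite ler0_norm//; have : 0 <= (x + 1 / 2) ^+ 2 by exact: sqr_ge0.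
  lra.
have i0 : 0 < de^-1 by rewrite invr_gt0.
rewrite gtr0_norm// in xM *.
have [xb|xb] := leP x be.
  rewrite stein_drift_left// stein_diffusion_mid//; last lra.
  have : de * x <= 1 * x by rewrite ler_pM2r.
  have : 0 <= (x - 3 / 4) ^+ 2 by exact: sqr_ge0.
  lra.
have bx := ltW xb; rewrite stein_drift_right// stein_diffusion_right//.
have db : de * be <= 1 * be by rewrite ler_pM2r.
case: be_or_M => [b1|M_eq1].
  have : x / M <= be * x.
    by rewrite ler_pdivrMr// mulrAC -[X in X <= _]mul1r ler_pM2r// mulrC.
  lra.
move: Mbe; rewrite M_eq1 divr1 mul1r => b1.
have : 0 <= (be - 1) * (x - be) by apply: mulr_ge0; lra.
have : 0 <= (be - 3 / 4) ^+ 2 by exact: sqr_ge0.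
lra.
Qed.

(** Integrate the previous inequality over [-j, j]: the integral of the
generator is the boundary term kap j (E(j) + E(-j)) / 2 >= 0. *)
Lemma diffusion_first_moment : (\int[nu]_x `|x|%:E <= (2 * M)%:E)%E.
Proof.
params; have M0 : 0 < M by lra.
pose A j := `[- j%:R : R, j%:R]%classic.
have cabs : continuous (fun x : R => `|x|) by exact: norm_continuous.
have mabs U : measurable_fun U (fun x : R => `|x|%:E).
  by apply: measurable_funTS; apply/measurable_EFinP; exact: continuous_measurable_fun.
have nd : nondecreasing_seq (fun j => A j.+1).
  apply/nondecreasing_seqP => j; rewrite subsetEset /A => x /=.
  rewrite !in_itv/= => /andP[xj jx].
  have : j.+1%:R <= j.+2%:R :> R by rewrite ler_nat.
  by move=> h; apply/andP; split; lra.
have := @ge0_nondecreasing_set_cvg_integral _ (measurableTypeR R) R (fun j => A j.+1)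
  (fun x : R => `|x|%:E) nu nd (fun j => measurable_itv _) (fun j => mabs _).
have -> : \bigcup_j A j.+1 = [set: R].
  apply/seteqP; split => // x _; exists (Num.truncn `|x|) => //=.
  by rewrite /A/= in_itv/= -ler_norml; exact/ltW/truncnS_gt.
have abs0 j (x : R) : A j.+1 x -> (0 <= `|x|%:E)%E by rewrite lee_fin.
move=> /(_ abs0) cv; apply: (cvge_to_le cv); apply: nearW => j /=.
have j0 : - j.+1%:R < j.+1%:R :> R.
  by have : 0 < j.+1%:R :> R by []; lra.
have mA : measurable (A j.+1) by exact: measurable_itv.
rewrite (ge0_integral_density cf nuE)//.
pose d x := (a x / 2 + b x * x) * f x.
pose G x := kap * (E x * x / 2).
have dG (x : R) : is_derive x 1 G (d x).
  have := is_derive_half_weight de0 dE (is_derive_id x 1) => h.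
  have H := is_deriveZ kap h.
  have -> : d x = kap *: ((a x / 2 * 1 + b x * x) * E x / a x).
    by rewrite /d /f /GRing.scale /=; ring.
  exact: H.
have cd : continuous d.
  move=> x; apply: cvgM; last exact: cf.
  apply: cvgD; first by apply: cvgM; [exact: continuous_stein_diffusion|exact: cvg_cst].
  by apply: cvgM; [exact: continuous_stein_drift|exact: cvg_id].
have intd := Rintegral_derive j0 dG cd.
have cxf : continuous (fun x => `|x| * f x).
  by move=> x; apply: cvgM; [exact: cabs|exact: cf].
have -> : (\int[mu]_(x in A j.+1) (`|x|%:E * (f x)%:E) =
    (\int[mu]_(x in A j.+1) (`|x| * f x)%R)%:E)%E.
  rewrite /Rintegral fineK//; apply: integrable_fin_num => //.
  exact: continuous_integrable_itv.
have cZ (k : R) (g : R -> R) : continuous g -> continuous (fun x => k * g x).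
  by move=> cg x; apply: cvgM; [exact: cvg_cst|exact: cg].
have iZ (k : R) (g : R -> R) : continuous g -> 
    mu.-integrable (A j.+1) (EFin \o (fun x => k * g x)).
  by move=> cg; apply: continuous_integrable_itv; exact: cZ.
rewrite lee_fin.
apply: (@le_trans _ _ (\int[mu]_(x in A j.+1) (2 * M * f x - M * d x))).
  apply: le_Rintegral => //.
  - exact: continuous_integrable_itv.
  - apply: continuous_integrable_itv => x; apply: cvgB; exact: cZ.
  - move=> x _; rewrite /d.
    have : `|x| <= 2 * M - M * (a x / 2 + b x * x).
      have := lyapunov x; rewrite -(ler_pM2l M0) mulrBr mulrCA divff ?gt_eqF// mulr1; lra.
    by move=> /(ler_wpM2r (f_ge0 x)); lra.
rewrite RintegralB//; [|exact: iZ|exact: iZ].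
rewrite !RintegralZl//; [|exact: continuous_integrable_itv|exact: continuous_integrable_itv].
rewrite intd.
have G0 : 0 <= G j.+1%:R - G (- j.+1%:R).
  rewrite /G -mulrBr; apply: mulr_ge0; first exact: ltW.
  rewrite mulrN mulNr opprK.
  by apply: addr_ge0; apply: divr_ge0 => //; rewrite mulr_ge0// ltW.
have mass : \int[mu]_(x in A j.+1) f x <= 1.
  rewrite /Rintegral -nuE// -lee_fin fineK ?probability_le1//.
  exact: fin_num_measure.
have : M * (G j.+1%:R - G (- j.+1%:R)) >= 0 by apply: mulr_ge0 => //; exact: ltW.
have : 2 * M * \int[mu]_(x in A j.+1) f x <= 2 * M * 1 by rewrite ler_wpM2l//; lra.
move=> h1 h2; rewrite lerBlDr; apply: le_trans h1 _.
by rewrite mulr1 lerDl.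
Qed.

Section test_function.
Variables (h h' : R -> R).
Hypotheses (dh : forall x : R, is_derive x 1 h (h' x))
  (h_lip : forall x y, `|h x - h y| <= `|x - y|).

Let ch : continuous h := is_derive_continuous dh.

Let mh U : measurable_fun U (EFin \o h : measurableTypeR R -> \bar R).
Proof. by apply: measurable_funTS; apply/measurable_EFinP; exact: continuous_measurable_fun. Qed.

Let abs_integrable : nu.-integrable setT (fun x : R => `|x|%:E).
Proof.
apply/integrableP; split.
  apply/measurable_EFinP; apply: continuous_measurable_fun; exact: norm_continuous.
under eq_integral do rewrite /= normr_id.
exact: le_lt_trans diffusion_first_moment (ltry _).
Qed.

Lemma Lip1_integrable : nu.-integrable setT (EFin \o h).
Proof.
apply: (@le_integrable _ _ _ nu setT measurableT _ (fun x : R => (`|h 0| + `|x|)%:E)) => //.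
  move=> x _; rewrite /= lee_fin [leRHS]ger0_norm ?addr_ge0//.
  have -> : h x = h 0 + (h x - h 0) by ring.
  apply: le_trans (ler_normD _ _) _; rewrite lerD2l.
  by have := h_lip x 0; rewrite subr0.
have -> : (fun x : R => (`|h 0| + `|x|)%:E) = (cst `|h 0|%:E \+ (fun x : R => `|x|%:E))%E.
  by apply/funext => x; rewrite EFinD.
by apply: integrableD => //; apply: finite_measure_integrable_cst.
Qed.

Let mean_cst (c : R) : \int[nu]_y c = c.
Proof.
have nuT : fine (nu setT) = 1 by rewrite probability_setT.
by rewrite (Rintegral_cst _ measurableT) nuT mulr1.
Qed.

Definition diffusion_mean : R := \int[nu]_x h x.

(** Average |h x - h y| <= |x| + |y| over y. *)
Lemma Lip1_sub_mean_le x : `|h x - diffusion_mean| <= `|x| + 2 * M.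
Proof.
have ih := Lip1_integrable.
have icst (c : R) : nu.-integrable setT (EFin \o cst c).
  exact: finite_measure_integrable_cst.
have -> : h x - diffusion_mean = \int[nu]_y (h x - h y).
  by rewrite -[X in X - _]mean_cst; apply/esym/(RintegralB measurableT (icst (h x)) ih).
have iB : nu.-integrable setT (EFin \o (fun y => h x - h y)).
  exact: (integrableB measurableT (icst (h x)) ih).
apply: le_trans (le_normr_Rintegral _ iB) _ => //.
apply: (@le_trans _ _ (\int[nu]_y (`|x| + `|y|))).
  apply: le_Rintegral => //.
  - exact: integrable_norm iB.
  - exact: (integrableD measurableT (icst `|x|) abs_integrable).
  - move=> y _; apply: le_trans (h_lip x y) _; exact: ler_normB.
have -> : \int[nu]_y (`|x| + `|y|) = `|x| + \int[nu]_y `|y|.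
  rewrite -[X in _ = X + _]mean_cst.
  exact: (RintegralD measurableT (icst `|x|) abs_integrable).
rewrite lerD2l -lee_fin fineK ?integrable_fin_num//.
exact: diffusion_first_moment.
Qed.

Let r x := h x - diffusion_mean.

Let cr : continuous r.
Proof. by move=> x; apply: cvgB; [exact: ch|exact: cvg_cst]. Qed.

Let ir : nu.-integrable setT (EFin \o r).
Proof.
have icst := finite_measure_integrable_cst nu diffusion_mean.
exact: (integrableB measurableT Lip1_integrable (icst _ measurableT)).
Qed.

Let q x := r x * f x.

Let cq : continuous q.
Proof. by move=> x; apply: cvgM; [exact: cr|exact: cf]. Qed.

Let iq : mu.-integrable setT (EFin \o q).
Proof.
apply/integrableP; split.
  by apply/measurable_EFinP; exact: continuous_measurable_fun.
have := ge0_integral_density cf nuE measurableT (phi := fun x : R => `|r x|%:E).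
have mr : measurable_fun setT (fun x : measurableTypeR R => `|r x|%:E).
  apply/measurable_EFinP; apply: continuous_measurable_fun => x.
  by apply: continuous_comp; [exact: cr|exact: norm_continuous].
move=> /(_ mr) E1.
have {}E1 := E1 (fun x => abse_ge0 (r x)%:E).
have -> : (\int[mu]_x `|(EFin \o q) x| = \int[nu]_x `|r x|%:E)%E.
  rewrite E1; apply: eq_integral => x _.
  by rewrite /q /= normrM (ger0_norm (f_ge0 x)) EFinM.
by have /integrableP[] := ir.
Qed.

(** The integral of the centered test function over ]-oo, x] vanishes at +oo
precisely because the function has mean zero. *)
Lemma stein_numerator : exists J : R -> R,
  [/\ forall x : R, is_derive x 1 J ((h x - diffusion_mean) * E x / a x),
      J (- j%:R) @[j --> \oo] --> 0 & J j%:R @[j --> \oo] --> 0].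
Proof.
pose Q (x : R) : R := \int[mu]_(t in `]-oo, x]) q t.
exists (fun x => kap^-1 * Q x); split.
- move=> x.
  have [d1 d2] : derivable Q x 1 /\ (Q^`())%classic x = q x.
    apply: (@continuous_FTC1 _ q -oo%O x (x + 1)) => //; first by rewrite ltrDl.
    - by apply: integrableS iq.
    - by rewrite ltNyr.
    - exact: cq.
  have H : is_derive x 1 Q (q x) by rewrite -d2 derive1E; exact: derivableP.
  have H2 := is_deriveZ kap^-1 H.
  have -> : (h x - diffusion_mean) * E x / a x = kap^-1 *: q x.
    have a0 : a x != 0 by rewrite gt_eqF// stein_diffusion_gt0.
    by rewrite /q /f /r /GRing.scale /=; field; rewrite a0 gt_eqF.
  exact: H2.
- have [t1 _] := cvg_tail_integral iq.
  by rewrite -(mulr0 kap^-1); apply: cvgM; [exact: cvg_cst|exact: t1].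
- have [_ t2] := cvg_tail_integral iq.
  have q0 : \int[mu]_t q t = 0.
    have := integral_density cf nuE measurableT ir.
    rewrite /Rintegral => H.
    rewrite (_ : (\int[mu]_x (q x)%:E) = (\int[nu]_x (r x)%:E))%E; last first.
      by rewrite H; apply: eq_integral => x _; rewrite /q EFinM.
    have -> : fine (\int[nu]_x (r x)%:E)%E = \int[nu]_x (h x - cst diffusion_mean x) by [].
    rewrite RintegralB//; last 2 first.
    - exact: Lip1_integrable.
    - exact: finite_measure_integrable_cst.
    have -> : \int[nu]_x cst diffusion_mean x = diffusion_mean by exact: mean_cst.
    exact: subrr.
  by rewrite -(mulr0 kap^-1) -q0; apply: cvgM; [exact: cvg_cst|exact: t2].
Qed.

End test_function.
End stationary_diffusion.

(** * The error of the diffusion approximation *)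

Section stein_error.
Context {R : realType}.
Variables (de be B K : R) (n : nat) (x m : nat -> R) (g g' r r' : R -> R).
Hypotheses (de0 : 0 < de) (de1 : de <= 1) (be0 : 0 < be) (n0 : (0 < n)%N).
Hypotheses (x0 : x 0%N = - de^-1) (xS : forall k, x k.+1 = x k + de).
Hypothesis xn : x n = be.
Hypotheses (m_ge0 : forall k, 0 <= m k).
Hypothesis m_le1 : forall N, \sum_(k < N) m k <= 1.
Hypothesis m_balance :
  forall k, m k = (1 + de * Num.min (x k.+1) be) * m k.+1.
Hypotheses (B1 : 1 <= B) (Bbe : 1 <= B * be).
Hypotheses (dg : forall x : R, is_derive x 1 g (g' x))
  (g_eq : forall x, stein_diffusion de be x / 2 * g' x = r x - stein_drift be x * g x)
  (dr : forall x : R, is_derive x 1 r (r' x))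
  (r_lip : forall x y, `|r x - r y| <= `|x - y|)
  (r'_lip : forall x y, `|r' x - r' y| <= `|x - y|)
  (r_bound : forall x, `|r x| <= `|x| + B)
  (g_left : forall x, x <= be -> `|g x| <= B)
  (K0 : 0 <= K) (g_growth : forall x, `|g x| <= K * (1 + `|x|)).

Let e k := 1 + de * Num.min (x k) be.
Let rem k := stein_rem de g g' (e k) (x k).

Let rem_lt k : (k < n)%N -> `|rem k| <= 102 * B * (1 + `|x k|) ^+ 3 * de ^+ 2.
Proof.
move=> kn; have xk1 : x k + de <= be by rewrite -xn (grid_lt de0 de1 be0 xS).
have xk : x k <= be by have := de0; lra.
rewrite /rem /e (min_l xk); case: k kn xk1 xk => [_ xk1 _|k kn xk1 xk].
  rewrite x0 mulrN divff ?gt_eqF// subrr.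
  rewrite x0 in xk1; apply: le_trans (stein_rem_zero de0 de1 be0 B1 dg g_eq r_lip r_bound g_left xk1) _.
  rewrite ler_wpM2r ?sqr_ge0// ler_wpM2r ?exprn_ge0 ?addr_ge0//.
  by have := B1; lra.
have xk0 : - de^-1 <= x k.+1 - de.
  by have := grid_lt de0 de1 be0 xS (ltn0Sn k); rewrite x0; lra.
exact: (stein_rem_left de0 de1 be0 B1 dg g_eq dr r_lip r'_lip r_bound g_left).
Qed.

Let rem_n : `|rem n| <= 13 * B * (1 + be) ^+ 3 * de.
Proof.
rewrite /rem /e xn minxx.
have h : - de^-1 <= be - de by have := grid_lt de0 de1 be0 xS n0; rewrite x0 xn; lra.
exact: (stein_rem_kink de0 de1 be0 B1 Bbe dg g_eq dr r_lip r'_lip r_bound g_left K0 g_growth).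
Qed.

Let rem_gt k : (n < k)%N -> `|rem k| <= 5 / 2 * de ^+ 2.
Proof.
move=> nk; have h : be <= x k - de by have := grid_lt de0 de1 be0 xS nk; rewrite xn; lra.
rewrite /rem /e min_r; last by have := de0; lra.
exact: (stein_rem_right de0 de1 be0 B1 dg g_eq dr r_lip r'_lip K0 g_growth).
Qed.

(** K1 / B bounds the mass of the left part and K2 de / B the weighted mass at
the kink; they cancel the factor B of the remainders there. *)
Lemma stein_error_bound (K1 K2 : R) (N : nat) :
  B * \sum_(k < n.+1) m k <= K1 -> B * (m n * (1 + be) ^+ 3) <= K2 * de ->
  `|\sum_(k < (n + N).+1) m k * r (x k)| <=
    (102 * 20 * K1 + 13 * K2 + 5 / 2) * de ^+ 2
    + `|m (n + N)%N * ((g (x (n + N)%N) + g (x (n + N)%N + de)) / (2 * de))|.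
Proof.
move=> HP Hn.
have := sum_stein de0 de1 be0 x0 xS m_balance (fun t => (g t + g (t + de)) / (2 * de)) (n + N).
rewrite (eq_bigr (fun k : 'I_(n + N).+1 => m k * r (x k) + m k * rem k)); last first.
  move=> k _; rewrite -mulrDr; congr (_ * _); rewrite /rem.
  have i0 : 0 < de^-1 by rewrite invr_gt0.
  have mk : - de^-1 <= Num.min (x k) be.
    by rewrite le_min (grid_ge0 de0 de1 be0 x0 xS)/=; have := be0; lra.
  apply: (stein_rem_eq de0 g_eq).
    by rewrite /stein_diffusion (max_r mk) /e; ring.
  by rewrite /stein_drift /e; ring.
rewrite big_split /= => <-.
set S := \sum_(k < _) m k * r _; set W := \sum_(k < _) m k * rem k.
suff : `|W| <= (102 * 20 * K1 + 13 * K2 + 5 / 2) * de ^+ 2.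
  move=> hW; have := ler_normD (- W) (S + W); rewrite normrN.
  by rewrite (_ : - W + (S + W) = S); [move=> /le_trans; apply; rewrite lerD2r|ring].
apply: le_trans (ler_norm_sum _ _ _) _.
rewrite -addSn big_split_ord /= big_ord_recr /=.
have h1 : \sum_(k < n) `|m k * rem k| <= 102 * 20 * K1 * de ^+ 2.
  apply: (@le_trans _ _ (\sum_(k < n) (102 * B * de ^+ 2) * (m k * (1 + `|x k|) ^+ 3))).
    apply: ler_sum => k _; rewrite normrM (ger0_norm (m_ge0 k)).
    by have := ler_wpM2l (m_ge0 k) (rem_lt (ltn_ord k)); lra.
  rewrite -mulr_sumr.
  have c0 : 0 <= 102 * B * de ^+ 2 by rewrite mulr_ge0 ?sqr_ge0//; have := B1; lra.
  apply: (@le_trans _ _ (102 * B * de ^+ 2 * (20 * \sum_(k < n.+1) m k))).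
    rewrite ler_wpM2l//; apply: le_trans (left_cubic_moment de0 de1 be0 x0 xS xn m_ge0 m_balance).
    by rewrite big_ord_recr /= lerDl mulr_ge0// exprn_ge0// addr_ge0.
  have := ler_wpM2r (sqr_ge0 de) HP; lra.
have h2 : `|m n * rem n| <= 13 * K2 * de ^+ 2.
  rewrite normrM (ger0_norm (m_ge0 n)).
  have := ler_wpM2l (m_ge0 n) rem_n.
  have := ler_wpM2r (ltW de0) Hn; lra.
have h3 : \sum_(i < N) `|m (n.+1 + i)%N * rem (n.+1 + i)%N| <= 5 / 2 * de ^+ 2.
  apply: (@le_trans _ _ (\sum_(i < N) 5 / 2 * de ^+ 2 * m (n.+1 + i)%N)).
    apply: ler_sum => i _; rewrite normrM (ger0_norm (m_ge0 _)) mulrC.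
    by rewrite ler_wpM2r// rem_gt// addSn ltnS leq_addr.
  rewrite -mulr_sumr -[X in _ <= X]mulr1 ler_wpM2l//.
    by rewrite mulr_ge0 ?sqr_ge0//; lra.
  apply: le_trans (m_le1 (n.+1 + N)); rewrite big_split_ord /= lerDr.
  by rewrite sumr_ge0.
lra.
Qed.

Lemma boundary_term_cvg0 :
  m N * ((g (x N) + g (x N + de)) / (2 * de)) @[N --> \oo] --> 0.
Proof.
have := cvg_weighted_mass de0 de1 be0 x0 xS xn m_ge0 m_le1 m_balance.
move=> /(cvgM (cvg_cst (3 * K / (2 * de)))); rewrite mulr0 => c0.
apply/norm_cvg0P.
apply: (@squeeze_cvgr _ _ _ _ (cst 0) (fun N => 3 * K / (2 * de) * (m N * (1 + `|x N|)))) => //.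
  apply: nearW => N; rewrite normr_ge0 /=.
  rewrite normrM (ger0_norm (m_ge0 N)) mulrCA ler_wpM2l//.
  rewrite normrM normfV (gtr0_norm (_ : 0 < 2 * de)) ?mulr_gt0// mulrAC.
  rewrite ler_wpM2r ?invr_ge0 ?mulr_ge0 ?(ltW de0)//.
  apply: le_trans (ler_normD _ _) _.
  apply: le_trans (lerD (g_growth _) (g_growth _)) _.
  have : `|x N + de| <= `|x N| + 1.
    by rewrite (le_trans (ler_normD _ _))// lerD2l gtr0_norm.
  move=> /(ler_wpM2l K0); have : 0 <= K * `|x N| by rewrite mulr_ge0.
  lra.
exact: cvg_cst.
Qed.

End stein_error.


(** * Expectations under a law on the natural numbers *)

Section discrete_law.
Context {R : realType} {d : measure_display} {T : measurableType d}.
Variables (P : probability T R) (X : {RV P >-> nat}).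

Definition pmf_nat k : R := fine (distribution P X [set k]).

Lemma distribution_set1E k : distribution P X [set k] = (pmf_nat k)%:E.
Proof. by rewrite /pmf_nat fineK// fin_num_measure. Qed.

Lemma pmf_nat_ge0 k : 0 <= pmf_nat k.
Proof. exact: fine_ge0. Qed.

Let natT : [set: nat] = \bigcup_k [set k].
Proof. by apply/seteqP; split => // k _; exists k. Qed.

Let nat_triv : trivIset setT (fun k : nat => [set k]).
Proof. by apply/trivIsetP => i j _ _ ij; apply/seteqP; split => // k [/= -> /eqP]; rewrite (negbTE ij). Qed.

Lemma pmf_nat_series : (\sum_(i <oo) (pmf_nat i)%:E = 1)%E.
Proof.
under eq_eseriesr do rewrite -distribution_set1E.
rewrite -[RHS](probability_setT (distribution P X)) natT measure_bigcup//.
by apply: eq_eseriesl => k; rewrite in_setT.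
Qed.

(** Absolute convergence is asked for through a bound on the partial sums, which
also yields integrability. *)
Lemma expectation_nat (h : nat -> R) (K : R) :
  (forall N, \sum_(k < N) pmf_nat k * `|h k| <= K) ->
  exists2 l : R, ('E_P[h \o X] = l%:E)%E &
    \sum_(k < N) pmf_nat k * h k @[N --> \oo] --> l.
Proof.
move=> hK; set mu := distribution P X.
have mh (U : set nat) (f : nat -> \bar R) : measurable_fun U f by [].
have int1 (f : nat -> R) k : (\int[mu]_(x in [set k]) (f x)%:E = (pmf_nat k * f k)%:E)%E.
  rewrite (eq_integral (fun=> (f k)%:E)); last by move=> i; rewrite inE => ->.
  by rewrite integral_cst// EFinM -distribution_set1E muleC.
have c0 : cvgn (series (fun k => `|pmf_nat k * h k|)).
  apply: nondecreasing_is_cvgn; first by apply: nondecreasing_series.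
  exists K => _ [N _ <-]; rewrite /series /= big_mkord.
  by under eq_bigr do rewrite normrM (ger0_norm (pmf_nat_ge0 _)); exact: hK.
have c1 : cvgn (series (fun k => pmf_nat k * h k)) by exact: normed_cvg.
have ih : mu.-integrable setT (EFin \o h).
  apply/integrableP; split => //.
  rewrite natT ge0_integral_bigcup//.
  under eq_eseriesr do rewrite /= (int1 (fun k => `|h k|)).
  apply: (@le_lt_trans _ _ K%:E); last exact: ltry.
  apply: lime_le; first by apply: is_cvg_nneseries => k _ _; rewrite lee_fin mulr_ge0// pmf_nat_ge0.
  by apply: nearW => N; rewrite sumEFin lee_fin big_mkord.
exists (limn (series (fun k => pmf_nat k * h k))).
  rewrite unlock -[LHS](@integral_distribution _ _ _ _ _ P X (EFin \o h))//; last first.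
    apply/integrableP; split; first exact: (measurableT_comp (mh setT (EFin \o h)) (measurable_funPT X)).
    have := @ge0_integral_distribution _ _ _ _ _ P X (fun k => `|(h k)%:E|)%E (mh _ _).
    by move=> <- //; have /integrableP[] := ih.
  rewrite -/mu natT integral_bigcup//; last by rewrite -natT.
  under eq_eseriesr do rewrite /= int1.
  apply/cvg_lim => //.
  rewrite (_ : (fun N => _) = EFin \o series (fun k => pmf_nat k * h k)).
    by apply: cvg_EFin; [exact: nearW|exact: c1].
  by apply/funext => N; rewrite /= /series /= sumEFin.
under eq_fun do rewrite -(big_mkord predT (fun k => pmf_nat k * h k)).
exact: c1.
Qed.

End discrete_law.

(** * The Erlang-C system *)

Section erlang_parameters.
Context {R : realType}.
Variables (n : nat) (lambda mu : R).
Hypotheses (load1 : 1 <= load lambda mu) (loadn : load lambda mu < n%:R).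

Local Notation rho := (load lambda mu).
Local Notation de := (delta lambda mu).
Local Notation be := (- zeta n lambda mu).
Local Notation x := (scaled_count lambda mu).

Let rho0 : 0 < rho.
Proof. exact: lt_le_trans load1. Qed.

Lemma delta_gt0 : 0 < de.
Proof. by rewrite invr_gt0 sqrtr_gt0. Qed.

Lemma delta_sqr : de ^+ 2 = rho^-1.
Proof. by rewrite /delta exprVn sqr_sqrtr// ltW. Qed.

Lemma delta_load : de * rho = de^-1.
Proof.
by apply: (mulfI (lt0r_neq0 delta_gt0)); rewrite mulrA -expr2 delta_sqr mulVf ?divff ?gt_eqF// delta_gt0.
Qed.

Lemma delta_le1 : de <= 1.
Proof.
rewrite /delta invf_le1 ?sqrtr_gt0//.
by rewrite -[X in X <= _](@sqrtr1 R) ler_wsqrtr.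
Qed.

Lemma zetaN : be = de * (n%:R - rho).
Proof. by rewrite /zeta -mulrN opprB. Qed.

Lemma zetaN_gt0 : 0 < be.
Proof. by rewrite zetaN mulr_gt0 ?delta_gt0// subr_gt0. Qed.

Lemma scaled_count0 : x 0%N = - de^-1.
Proof. by rewrite /scaled_count sub0r mulrN delta_load. Qed.

Lemma scaled_countS k : x k.+1 = x k + de.
Proof. by rewrite /scaled_count -natr1; ring. Qed.

Lemma scaled_count_servers : x n = be.
Proof. by rewrite /scaled_count zetaN. Qed.

Lemma service_rateE k : 1 + de * Num.min (x k) be = rho^-1 * (minn k n)%:R.
Proof.
have -> : Num.min (x k) be = de * ((minn k n)%:R - rho).
  rewrite zetaN /scaled_count; have d0 := delta_gt0.
  have [kn|nk] := leqP k n.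
    by rewrite min_l// ler_pM2l// lerD2r ler_nat.
  by rewrite min_r// ler_pM2l// lerD2r ler_nat ltnW.
by rewrite mulrA -expr2 delta_sqr; field; rewrite gt_eqF.
Qed.

Lemma driftE y : drift n lambda mu y = mu * stein_drift be y.
Proof.
rewrite /drift /stein_drift; case: ifPn => [h|].
  by rewrite min_l//; ring.
by rewrite -ltNge => /ltW h; rewrite min_r//; ring.
Qed.

Lemma diffusionE y : diffusion n lambda mu y = mu * stein_diffusion de be y.
Proof.
have d0 := delta_gt0; have b0 := zetaN_gt0.
have i0 : 0 < de^-1 by rewrite invr_gt0.
rewrite /diffusion /stein_diffusion; case: ifPn => [h|].
  rewrite max_l ?ge_min ?h//.
  by rewrite mulrN divff ?gt_eqF//; ring.
rewrite -ltNge => /ltW h; case: ifPn => [h'|].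
  by rewrite min_l// max_r.
rewrite -ltNge => /ltW h'; rewrite min_r// max_r; last lra.
by rewrite -normrN gtr0_norm.
Qed.

End erlang_parameters.

(** The theorem for abstract chain weights m and an abstract weight E of the
diffusion.  B = 21 M; the factors 16 and 56 come from M P(X <= n) <= 16 and
M P(X = n) (1 + be)^3 <= 56 de, checked separately for be <= 1 and be >= 1. *)
Lemma W2_stein_bound {R : realType} (de be kap : R) (n : nat) (x m : nat -> R)
    (E : R -> R) (nu : probability (measurableTypeR R) R) (h : R -> R) :
  0 < de -> de <= 1 -> 0 < be -> (0 < n)%N -> 0 < kap ->
  x 0%N = - de^-1 -> (forall k, x k.+1 = x k + de) -> x n = be ->
  (forall k, 0 <= m k) -> (\sum_(k <oo) (m k)%:E = 1)%E ->
  (forall k, m k = (1 + de * Num.min (x k.+1) be) * m k.+1) ->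
  (forall y, 0 < E y) ->
  (forall y : R, is_derive y 1 E (2 * stein_drift be y / stein_diffusion de be y * E y)) ->
  (forall A, measurable A ->
    nu A = (\int[@lebesgue_measure R]_(y in A) (kap * E y / stein_diffusion de be y)%:E)%E) ->
  W2 h ->
  [/\ nu.-integrable setT (EFin \o h),
      exists K, forall N, \sum_(k < N) m k * `|h (x k)| <= K &
      forall l, \sum_(k < N) m k * h (x k) @[N --> \oo] --> l ->
      `|l - \int[nu]_y h y| <= (102 * 20 * (21 * 16) + 13 * (21 * 56) + 5 / 2) * de ^+ 2].
Proof.
move=> de0 de1 be0 n0 kap0 x0 xS xn m0 m_sum m_bal E0 dE nuE [dh h_lip h'_lip].
have m_le1 : forall N, \sum_(k < N) m k <= 1 := nneseries_EFin_ub m0 m_sum.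
have m_cvg := nneseries_EFin_cvg m0 m_sum.
pose M := if be <= 1 then be^-1 else 1.
have M1 : 1 <= M by rewrite /M; case: ifP => // b1; rewrite invf_ge1.
have Mbe : 1 <= M * be.
  by rewrite /M; case: ifPn => [_|]; [rewrite mulVf// gt_eqF|rewrite -ltNge mul1r => /ltW].
have beM : be <= 1 \/ M = 1 by rewrite /M; case: ifP => _; [left|right].
have dh' (y : R) : is_derive y 1 h ((h^`())%classic y).
  by rewrite derive1E; apply: derivableP.
have ih := Lip1_integrable de0 de1 be0 kap0 M1 Mbe beM E0 dE nuE dh' h_lip.
split=> //.
  have [K HK] := weighted_mass_bounded de0 de1 be0 x0 xS xn m0 m_le1 m_bal.
  exists ((`|h 0| + 1) * K) => N.
  apply: (@le_trans _ _ ((`|h 0| + 1) * \sum_(k < N) m k * (1 + `|x k|))); last first.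
    by rewrite ler_wpM2l// addr_ge0.
  rewrite mulr_sumr; apply: ler_sum => k _; rewrite mulrCA ler_wpM2l//.
  have -> : h (x k) = h 0 + (h (x k) - h 0) by ring.
  apply: le_trans (ler_normD _ _) _.
  apply: (@le_trans _ _ (`|h 0| + `|x k|)).
    by rewrite lerD2l; have := h_lip (x k) 0; rewrite subr0.
  have : 0 <= `|h 0| * `|x k| by rewrite mulr_ge0.
  have := normr_ge0 (x k); lra.
move=> l hl.
have [J [dJ JNy Jy]] := stein_numerator de0 de1 be0 kap0 M1 Mbe beM E0 dE nuE dh' h_lip.
have rb := Lip1_sub_mean_le de0 de1 be0 kap0 M1 Mbe beM E0 dE nuE dh' h_lip.
set hb := diffusion_mean nu h in dJ rb.
rewrite -[\int[nu]_y h y]/hb.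
pose r y := h y - hb.
have dr (y : R) : is_derive y 1 r ((h^`())%classic y).
  have H := is_deriveB (dh' y) (is_derive_cst hb y 1).
  by rewrite subr0 in H; exact: H.
have r_lip y z : `|r y - r z| <= `|y - z|.
  by rewrite /r opprB addrA subrK; exact: h_lip.
have rb' y : `|r y| <= `|y| + 21 * M by apply: le_trans (rb y) _; lra.
pose g := stein_sol E J.
pose g' := stein_sol' de be E J r.
have dg : forall y : R, is_derive y 1 g (g' y) := is_derive_stein_sol de0 E0 dE dJ.
have g_eq y : stein_diffusion de be y / 2 * g' y = r y - stein_drift be y * g y.
  exact: stein_equation.
have g_left y : y <= be -> `|g y| <= 21 * M.
  exact: (stein_sol_bound_left de0 de1 be0 E0 dE dJ JNy Jy rb M1 beM).
have [K K0 g_growth] := stein_sol_linear_growth de0 de1 be0 E0 dE dJ JNy Jy rb M1 beM.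
have B1 : 1 <= 21 * M by lra.
have Bbe : 1 <= 21 * M * be by lra.
have HP : 21 * M * \sum_(k < n.+1) m k <= 21 * 16.
  rewrite -mulrA ler_pM2l//; case: beM => [b1|->]; last by have := m_le1 n.+1; lra.
  have hP := left_mass de0 de1 be0 x0 xS xn m0 m_le1 m_bal b1.
  by rewrite /M b1 mulrC ler_pdivrMr.
have Hn : 21 * M * (m n * (1 + be) ^+ 3) <= 21 * 56 * de.
  rewrite -!mulrA ler_pM2l//.
  have [b1|/ltW b1] := leP be 1.
    have h1 := boundary_mass_le de0 de1 be0 x0 xS xn m0 m_le1 m_bal.
    have h2 : M * m n <= de by rewrite /M b1 mulrC ler_pdivrMr.
    have h3 : (1 + be) ^+ 3 <= 8.
      have -> : 8 = (1 + 1) ^+ 3 :> R by ring.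
      by apply: lerXn2r; rewrite ?nnegrE; lra.
    rewrite mulrA mulrC [56 * _]mulrC.
    apply: (@le_trans _ _ (8 * de)); last by lra.
    apply: ler_pM => //; first by rewrite exprn_ge0//; lra.
    by rewrite mulr_ge0//; lra.
  have M_eq1 : M = 1.
    by rewrite /M; case: ifP => // b2; have -> : be = 1 by [lra]; rewrite invr1.
  rewrite M_eq1 mul1r.
  have h1 := boundary_mass_tail de0 de1 be0 x0 xS xn m0 m_le1 m_bal.
  have h3 : (1 + be) ^+ 3 <= 8 * (be + de) ^+ 3.
    have -> : 8 * (be + de) ^+ 3 = (2 * (be + de)) ^+ 3 by ring.
    by apply: lerXn2r; rewrite ?nnegrE; lra.
  have := ler_wpM2l (m0 n) h3; lra.
have bound := stein_error_bound de0 de1 be0 n0 x0 xS xn m0 m_le1 m_bal B1 Bbe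
  dg g_eq dr r_lip h'_lip rb' g_left K0 g_growth _ HP Hn.
have c1 : \sum_(k < (n + N).+1) m k * r (x k) @[N --> \oo] --> l - hb.
  have c : \sum_(k < N) m k * r (x k) @[N --> \oo] --> l - hb.
    under eq_fun => N.
      rewrite (eq_bigr (fun k : 'I_N => m k * h (x k) - hb * m k)); last first.
        by move=> k _; rewrite /r; ring.
      rewrite sumrB -mulr_sumr; over.
    rewrite -[X in l - X]mulr1; apply: cvgB => //.
    by apply: cvgM => //; exact: cvg_cst.
  have := c; rewrite -(cvg_shiftn n.+1) => {}c.
  by under eq_fun do rewrite -addSn addnC.
have c2 := boundary_term_cvg0 de0 de1 be0 x0 xS xn m0 m_le1 m_bal K0 g_growth.
rewrite -(cvg_shiftn n) in c2.
set C := (X in _ <= X * _).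
have c3 : C * de ^+ 2 + `|m (N + n)%N * ((g (x (N + n)%N) + g (x (N + n)%N + de)) / (2 * de))|
    @[N --> \oo] --> C * de ^+ 2.
  rewrite -[X in _ --> X]addr0; apply: cvgD; first exact: cvg_cst.
  by rewrite -(@normr0 _ R); exact: cvg_norm.
apply: (ler_cvg_to (cvg_norm c1) c3); apply: nearW => N.
by rewrite [(N + n)%N]addnC; exact: bound.
Qed.

Theorem theorem3p1 (R : realType) :
  exists2 C : R, 0 < C &
  forall (n : nat) (lambda mu : R),
    (1 <= n)%N -> 0 < lambda -> 0 < mu ->
    1 <= load lambda mu -> load lambda mu < n%:R ->
  forall p : R -> nat -> nat -> R, erlangC_transition n lambda mu p ->
  forall (d1 : measure_display) (T1 : measurableType d1)
    (P1 : probability T1 R) (X : {RV P1 >-> nat}),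
    stationary_distribution p (distribution P1 X) ->
  forall (d2 : measure_display) (T2 : measurableType d2)
    (P2 : probability T2 R) (Y : {RV P2 >-> R}),
    diffusion_limit n lambda mu Y ->
  (dW2 P1 (scaled_count lambda mu \o X) P2 Y <= (C / load lambda mu)%:E)%E.
Proof.
exists (102 * 20 * (21 * 16) + 13 * (21 * 56) + 5 / 2); first lra.
move=> n lambda mu n0 la0 mu0 load1 loadn p [tp rp] d1 T1 P1 X stX d2 T2 P2 Y.
move=> [kappa kappa0 densY].
have load0 : 0 < load lambda mu by exact: lt_le_trans load1.
have de0 := delta_gt0 load1; have de1 := delta_le1 load1.
have be0 := zetaN_gt0 load1 loadn.
set de := delta lambda mu in de0 de1.
set be := - zeta n lambda mu in be0.
have m_bal k : pmf_nat X k =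
    (1 + de * Num.min (scaled_count lambda mu k.+1) be) * pmf_nat X k.+1.
  have db := birth_death_detailed_balance (Q := lambda + mu * n%:R + 1) tp rp.
  have lm : lambda * pmf_nat X k = mu * (minn k.+1 n)%:R * pmf_nat X k.+1.
    apply: db => //.
    - move=> j; have : (minn j n)%:R <= n%:R :> R by rewrite ler_nat geq_minr.
      by move=> /(ler_wpM2l (ltW mu0)); lra.
    - by have : 0 <= mu * n%:R by [rewrite mulr_ge0// ltW]; lra.
    - by rewrite min0n mulr0.
    - exact: pmf_nat_ge0.
    - exact: nneseries_EFin_cvg (pmf_nat_ge0 X) (pmf_nat_series X).
    - move=> t j t0.
      apply: (@nneseries_EFin_cvg R (fun i => pmf_nat X i * p t i j) (pmf_nat X j)).
        by move=> i; apply: mulr_ge0; [exact: pmf_nat_ge0|exact: (transition_ge0 tp)].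
      rewrite -distribution_set1E -(stX t j t0).
      by apply: eq_eseriesr => i _; rewrite EFinM distribution_set1E.
  rewrite service_rateE// /load; apply: (mulfI (lt0r_neq0 la0)); rewrite lm.
  by field; rewrite !gt_eqF.
pose c y := 2 * stein_drift be y / stein_diffusion de be y.
have cc : continuous c.
  move=> y; apply: cvgM.
    by apply: cvgM; [exact: cvg_cst|exact: continuous_stein_drift].
  apply: cvgV; first by rewrite gt_eqF// stein_diffusion_gt0.
  exact: continuous_stein_diffusion.
pose E y := expR (oriented_integral0 c y).
have dE (y : R) : is_derive y 1 E (c y * E y).
  rewrite mulrC; exact: is_derive1_comp (is_derive_expR _) (is_derive_oriented_integral0 cc y).
have mY : measurable_fun setT (Y : T2 -> measurableTypeR R) by exact: (measurable_funPT Y).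
(* the same random variable, for the Borel structure carrying lebesgue_measure *)
pose Y' : {mfun T2 >-> measurableTypeR R} :=
  HB.pack (Y : T2 -> measurableTypeR R) (isMeasurableFun.Build _ _ _ _ _ mY).
pose nu : probability (measurableTypeR R) R := distribution P2 Y'.
have kap0 : 0 < kappa / mu by rewrite divr_gt0.
have nuE A : measurable A -> nu A =
    (\int[@lebesgue_measure R]_(y in A) (kappa / mu * E y / stein_diffusion de be y)%:E)%E.
  move=> mA; rewrite [LHS](densY A mA); apply: eq_integral => y _; congr EFin.
  have a0 : stein_diffusion de be y != 0 by rewrite gt_eqF// stein_diffusion_gt0.
  rewrite diffusionE// -/de -/be.
  have -> : (fun y => 2 * drift n lambda mu y / diffusion n lambda mu y) = c.
    apply/funext => z; rewrite driftE diffusionE// -/de -/be /c.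
    have az : stein_diffusion de be z != 0 by rewrite gt_eqF// stein_diffusion_gt0.
    by field; rewrite az gt_eqF.
  by rewrite -/(E y); field; rewrite a0 gt_eqF.
apply: ge_ereal_sup => _ [h hW2 <-].
have [ih [K HK] bound] := W2_stein_bound de0 de1 be0 n0 kap0
  (scaled_count0 load1) (scaled_countS lambda mu) (scaled_count_servers n lambda mu)
  (pmf_nat_ge0 X) (pmf_nat_series X) m_bal (fun y => expR_gt0 _) dE nuE hW2.
have [l lE lcvg] := @expectation_nat _ _ _ _ X (h \o scaled_count lambda mu) K HK.
have -> : ('E_P1[h \o (scaled_count lambda mu \o X)] = l%:E)%E by rewrite -lE.
have -> : ('E_P2[h \o Y] = (\int[nu]_y h y)%:E)%E.
  rewrite /Rintegral fineK; last exact: integrable_fin_num.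
  apply/esym; rewrite unlock.
  apply: (@integral_distribution _ _ _ _ _ P2 Y' (EFin \o h)).
    exact: (measurable_int nu ih).
  apply/integrableP; split.
    exact: (measurableT_comp (measurable_int nu ih) mY).
  have mh : measurable_fun setT (fun y : measurableTypeR R => `|(h y)%:E|)%E.
    by apply: measurableT_comp => //; exact: (measurable_int nu ih).
  have := @ge0_integral_distribution _ _ _ _ _ P2 Y' (fun y => `|(h y)%:E|)%E mh.
  by move=> <- //; have /integrableP[] := ih.
rewrite -EFinB /= lee_fin -delta_sqr//; exact: bound.
Qed.
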